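(* Let $q_E\colon E\to M$ be a smooth vector bundle over a smooth manifold $M$. Let $[\![\cdot,\cdot]\!]$ be an $\mathbb R$-bilinear bracket on $\Gamma(TM\oplus E^* )$ that is anchored by $\mathrm{pr}_{TM}$ and satisfies the Leibniz identity in its second component, and let $\Xi\colon\Gamma(TM\oplus E^* )\to\Gamma^l_E(TE\oplus T^*E)$ be the corresponding lift. Then $[\![\cdot,\cdot]\!]$ is a Dorfman bracket if and only if $\Xi$ is natural, i.e. if and only if $$[\![\Xi(\nu_1),\Xi(\nu_2)]\!]=\Xi\big([\![\nu_1,\nu_2]\!]\big)\qquad\text{for all }\nu_1,\nu_2\in\Gamma(TM\oplus E^* ),$$ where the bracket on the left-hand side is the Courant-Dorfman bracket on sections of $TE\oplus T^*E\to E$.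
   Context: Everything is smooth. $TM\oplus E^*$ and $E\oplus T^*M$ are paired by $\langle(X,\varepsilon),(e,\theta)\rangle=\varepsilon(e)+\theta(X)$. Brackets. An $\mathbb R$-bilinear bracket $[\![\cdot,\cdot]\!]$ on $\Gamma(TM\oplus E^* )$ is anchored by $\mathrm{pr}_{TM}$ if $\mathrm{pr}_{TM}[\![\nu_1,\nu_2]\!]=[\mathrm{pr}_{TM}\nu_1,\mathrm{pr}_{TM}\nu_2]$, and satisfies the Leibniz identity in its second component if $[\![\nu_1,f\nu_2]\!]=f[\![\nu_1,\nu_2]\!]+(\mathrm{pr}_{TM}\nu_1)(f)\,\nu_2$ for all $f\in C^\infty(M)$. It is a Dorfman bracket if moreover it satisfies the Jacobi identity in Leibniz form $[\![\nu_1,[\![\nu_2,\nu_3]\!]]\!]=[\![[\![\nu_1,\nu_2]\!],\nu_3]\!]+[\![\nu_2,[\![\nu_1,\nu_3]\!]]\!]$. Courant-Dorfman bracket on a manifold $N$ (here $N$ is the total space $E$): $[\![(U,\alpha),(V,\beta)]\!]=([U,V],\mathcal L_U\beta-\mathbf i_V\mathbf d\alpha)$ for vector fields $U,V$ and $1$-forms $\alpha,\beta$ on $N$. Linear sections. $TE\to TM$ is the vector bundle obtained by applying the tangent functor to $E\to M$. $T^*E$ is a vector bundle over $E^*$ with projection $r_E$, $\langle r_E(\theta_{e_m}),e'_m\rangle=\langle\theta_{e_m},\frac{d}{dt}|_{t=0}(e_m+te'_m)\rangle$, and addition $\langle\theta_{e_m}+_{E^*}\omega_{e'_m},v_{e_m}+_{TM}v_{e'_m}\rangle=\langle\theta_{e_m},v_{e_m}\rangle+\langle\omega_{e'_m},v_{e'_m}\rangle$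 whenever $Tq_E(v_{e_m})=Tq_E(v_{e'_m})$. Thus $TE\oplus T^*E$ (sum over $E$) is also a vector bundle over $TM\oplus E^*$ with projection $\Phi_E=(Tq_E,r_E)$. A section $\chi$ of $TE\oplus T^*E\to E$ is linear over $(X,\varepsilon)\in\Gamma(TM\oplus E^* )$ if it is a vector bundle morphism from $E\to M$ to $TE\oplus T^*E\to TM\oplus E^*$ over $(X,\varepsilon)\colon M\to TM\oplus E^*$. $\Gamma_E^l(TE\oplus T^*E)$ is the space of linear sections. Notation. $\ell_\varepsilon\in C^\infty(E)$ is the linear function $e_m\mapsto\langle\varepsilon(m),e_m\rangle$. For $(e,\theta)\in\Gamma(E\oplus T^*M)$, $(e,\theta)^\uparrow(e'_m)=\big(\frac{d}{dt}|_{t=0}(e'_m+te(m)),(T_{e'_m}q_E)^*\theta(m)\big)$. Lift corresponding to a bracket. For $\nu=(X,\varepsilon)\in\Gamma(TM\oplus E^* )$ define the derivation $\mathcal D_\nu$ of $\Gamma(E\oplus T^*M)$ with symbol $X$ by $X\langle\nu',\tau\rangle=\langle\nu',\mathcal D_\nu\tau\rangle+\langle[\![\nu,\nu']\!],\tau\rangle$ for all $\nu'\in\Gamma(TM\oplus E^* )$, $\tau\in\Gamma(E\oplus T^*M)$. The corresponding lift is $$\Xi(X,\varepsilon)(e_m)=(T_me\,X(m),\mathbf d_{e_m}\ell_\varepsilon)-(\mathcal D_{(X,\varepsilon)}(e,0))^\uparrow(e_m)$$ for any $e\in\Gamma(E)$ with $e(m)=e_m$; $\Xi(\nu)$ is a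 linear section over $\nu$. *)

(* Defs.v *)
From HB Require Import structures.
From mathcomp Require Import all_boot all_order all_algebra.
From mathcomp Require Import mathcomp_extra boolp classical_sets functions.
From mathcomp Require Import ring.
From mathcomp Require Import reals topology normedtype landau derive.

Set Implicit Arguments.
Unset Strict Implicit.
Unset Printing Implicit Defensive.
Import Order.TTheory GRing.Theory Num.Theory.
Import numFieldNormedType.Exports.

Local Open Scope classical_set_scope.
Local Open Scope ring_scope.

(* f is C^k on the open set U. *)
Fixpoint Ck (R : realType) (n k : nat) (U : set 'rV[R]_n) (f : 'rV[R]_n -> R)
    : Prop :=
  if k is k'.+1 then
    (forall x, U x -> differentiable f x) /\ (forall v, Ck k' U ('D_v f))
  else forall x, U x -> {for x, continuous f}.

Definition smooth_on (R : realType) (n : nat) (U : set 'rV[R]_n)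
  (f : 'rV[R]_n -> R) : Prop := forall k, Ck k U f.

Section Calculus.
Variable R : realType.

Lemma near_eq_differentiable (V : normedModType R) (f g : V -> R) (x : V) :
  (\near x, f x = g x) -> differentiable f x -> differentiable g x.
Proof.
move=> fg df.
have E : g \o shift x = cst (g x) + 'd f x +o_ 0 id.
  have /eqaddoP H := diff_locally df.
  apply/eqaddoP => e e0; have := H _ e0.
  have fgx := nbhs_singleton fg.
  have fg0 : \forall y \near 0, f (y + x) = g (y + x).
    by move: fg; rewrite (near_shift 0) subr0.
  by apply: filterS2 fg0 => y /= E; rewrite !fctE /= E fgx.
have dgE := diff_unique (diff_continuous df) E.
apply/diff_locallyP; rewrite dgE; split=> //.
exact: diff_continuous.
Qed.

Implicit Types (n k : nat).

Lemma CkW n k (U : set 'rV[R]_n) f : Ck k.+1 U f -> Ck k U f.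
Proof.
elim: k f => [|k IH] f [df Df].
  by move=> x Ux; exact/differentiable_continuous/df.
by split=> // v; exact/IH/Df.
Qed.

Lemma Ck_local n k (U : set 'rV[R]_n) f :
  (forall x, U x -> exists V : set 'rV[R]_n, V x /\ Ck k V f) -> Ck k U f.
Proof.
elim: k f => [|k IH] f H.
  by move=> x Ux; have [V [Vx]] := H x Ux; apply.
split=> [x Ux|v]; first by have [V [Vx [dV _]]] := H x Ux; exact: dV.
by apply: IH => x Ux; have [V [Vx [_ DV]]] := H x Ux; exists V; split=> //; exact: DV.
Qed.

Lemma Ck_ext n k (U : set 'rV[R]_n) f g :
  open U -> (forall x, U x -> f x = g x) -> Ck k U f -> Ck k U g.
Proof.
move=> oU; elim: k f g => [|k IH] f g fg /=;
  have fgn x : U x -> \near x, f x = g x.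
  1,3: by move=> Ux; apply: filterS fg _; exact: open_nbhs_nbhs.
  move=> Cf x Ux; have := Cf x Ux.
  rewrite /prop_for /continuous_at -(fg x Ux) => fx.
  apply: cvg_trans fx; apply: (@near_eq_cvg _ _ (nbhs x)); exact: fgn.
move=> [df Df].
split=> [x Ux|v]; first exact: near_eq_differentiable (fgn x Ux) (df x Ux).
apply: IH (Df v) => x Ux; apply: near_eq_derive; exact: fgn.
Qed.

Lemma Ck_sub n k (U V : set 'rV[R]_n) f : U `<=` V -> Ck k V f -> Ck k U f.
Proof. by move=> UV Cf; apply: Ck_local => x Ux; exists V; split=> //; exact: UV. Qed.

Lemma Ck_cst n k (U : set 'rV[R]_n) (a : R) : Ck k U (cst a).
Proof.
elim: k a => [|k IH] a; first by move=> x _; exact: cst_continuous.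
split=> [x _|v]; first exact: differentiable_cst.
have -> : 'D_v (cst a) = cst 0 :> ('rV[R]_n -> R).
  by apply/funext => x; rewrite derive_cst.
exact: IH.
Qed.

Lemma CkD n k (U : set 'rV[R]_n) f g :
  open U -> Ck k U f -> Ck k U g -> Ck k U (f \+ g).
Proof.
move=> oU; elim: k f g => [|k IH] f g.
  by move=> Cf Cg x Ux; apply: continuousD; [exact: Cf|exact: Cg].
move=> [df Df] [dg Dg]; split=> [x Ux|v].
  by apply: differentiableD; [exact: df|exact: dg].
apply: Ck_ext (IH _ _ (Df v) (Dg v)) => // x Ux /=.
by rewrite -deriveD //; apply: diff_derivable; [exact: df|exact: dg].
Qed.

Lemma CkM n k (U : set 'rV[R]_n) f g :
  open U -> Ck k U f -> Ck k U g -> Ck k U (f \* g).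
Proof.
move=> oU; elim: k f g => [|k IH] f g.
  by move=> Cf Cg x Ux; apply: continuousM; [exact: Cf|exact: Cg].
move=> Cf Cg; have Cf' := CkW Cf; have Cg' := CkW Cg.
case: Cf Cg => [df Df] [dg Dg]; split=> [x Ux|v].
  by apply: differentiableM; [exact: df|exact: dg].
have := CkD oU (IH _ _ Cf' (Dg v)) (IH _ _ Cg' (Df v)).
apply: Ck_ext => // x Ux /=.
by rewrite -deriveM //; apply: diff_derivable; [exact: df|exact: dg].
Qed.

Lemma Ck_sum n k (U : set 'rV[R]_n) m (F : 'I_m -> 'rV[R]_n -> R) :
  open U -> (forall i, Ck k U (F i)) -> Ck k U (fun x => \sum_i F i x).
Proof.
move=> oU; elim: m F => [|m IH] F CF.
  by apply: Ck_ext (Ck_cst k U 0) => // x _; rewrite big_ord0.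
apply: Ck_ext (CkD oU (CF ord0) (IH (fun i => F (lift ord0 i)) _)) => //.
by move=> x _; rewrite big_ord_recl.
Qed.

Lemma Ck_coord n k (U : set 'rV[R]_n) (i : 'I_n) : Ck k U (fun y => y 0 i).
Proof.
case: k => [|k]; first by move=> x _; exact: coord_continuous.
split=> [x _|v]; first exact: differentiable_coord.
have -> : 'D_v (fun y : 'rV[R]_n => y 0 i) = cst (v 0 i) :> ('rV[R]_n -> R).
  apply/funext => x; rewrite deriveE; last exact: differentiable_coord.
  have lin : linear (fun y : 'rV[R]_n => y 0 i : R).
    by move=> a u w; rewrite !mxE.
  pose gL : {linear 'rV[R]_n -> R} :=
    HB.pack (fun y : 'rV[R]_n => y 0 i : R) (GRing.isLinear.Build _ _ _ _ _ lin).
  by rewrite (@diff_lin _ _ _ gL) //; exact: coord_continuous.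
exact: Ck_cst.
Qed.

Lemma differentiable_row (V : normedModType R) m (F : V -> 'rV[R]_m) x :
  (forall j, differentiable (fun y => F y 0 j) x) -> differentiable F x.
Proof.
move=> dF.
have -> : F = \sum_(j < m) (fun y => F y 0 j *: (delta_mx 0 j : 'rV[R]_m)).
  by apply/funext => y; rewrite fct_sumE [LHS]row_sum_delta.
by apply: differentiable_sum => j; exact: differentiableZl.
Qed.

Lemma continuous_row (V : normedModType R) m (F : V -> 'rV[R]_m) (x : V) :
  (forall j, {for x, continuous (fun y => F y 0 j)}) -> {for x, continuous F}.
Proof.
move=> cF.
have -> : F = (fun y => \sum_(j < m) F y 0 j *: (delta_mx 0 j : 'rV[R]_m)).
  by apply/funext => y; rewrite [LHS]row_sum_delta.
elim: (index_enum _) => [|j s IH].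
  have -> : (fun y => \sum_(j <- [::]) F y 0 j *: (delta_mx 0 j : 'rV[R]_m)) = cst 0.
    by apply/funext => y; rewrite big_nil.
  exact: cst_continuous.
have -> : (fun y => \sum_(j <- j :: s) F y 0 j *: (delta_mx 0 j : 'rV[R]_m)) =
    (fun y => F y 0 j *: (delta_mx 0 j : 'rV[R]_m)) \+
    (fun y => \sum_(j <- s) F y 0 j *: (delta_mx 0 j : 'rV[R]_m)).
  by apply/funext => y; rewrite big_cons.
by apply: continuousD => //; apply: cvgZr_tmp; exact: cF.
Qed.

Lemma Ck_comp n m k (U : set 'rV[R]_n) (W : set 'rV[R]_m) g F :
  open U -> (forall x, U x -> W (F x)) ->
  (forall j, smooth_on U (fun x => F x 0 j)) -> smooth_on W g ->
  Ck k U (fun x => g (F x)).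
Proof.
move=> oU UW CF; elim: k g => [|k IH] g Cg.
  move=> x Ux; apply: (@continuous_comp _ _ _ F g).
    by apply: continuous_row => j; exact: (CF j 0).
  exact: (Cg 0%N _ (UW _ Ux)).
have dF x : U x -> differentiable F x.
  by move=> Ux; apply: differentiable_row => j; have [+ _] := CF j 1%N; apply.
have dg x : U x -> differentiable g (F x).
  by move=> Ux; have [+ _] := Cg 1%N; apply; exact: UW.
split=> [x Ux|v]; first by apply: differentiable_comp; [exact: dF|exact: dg].
have H : Ck k U (fun x => \sum_j
    'D_v (fun y => F y 0 j) x * 'D_(delta_mx 0 j : 'rV[R]_m) g (F x)).
  apply: Ck_sum => // j; apply: CkM => //; first by have [_] := CF j k.+1; apply.
  by apply: (IH ('D_(delta_mx 0 j : 'rV[R]_m) g)) => l; have [_] := Cg l.+1; apply.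
apply: Ck_ext H => // x Ux.
rewrite [RHS](@deriveE _ _ _ (g \o F)); last first.
  by apply: differentiable_comp; [exact: dF|exact: dg].
rewrite (diff_comp (dF x Ux) (dg x Ux)).
rewrite /= -(@deriveE _ _ _ F x v (dF x Ux)).
rewrite [in RHS](row_sum_delta ('D_v F x)) linear_sum /=; apply: eq_bigr => j _.
rewrite linearZ /= -(@deriveE _ _ _ g (F x) _ (dg x Ux)).
congr (_ * _).
by rewrite (derive_mx (diff_derivable (dF x Ux))) mxE.
Qed.

Lemma smooth_on_comp n m (U : set 'rV[R]_n) (W : set 'rV[R]_m) g F :
  open U -> (forall x, U x -> W (F x)) ->
  (forall j, smooth_on U (fun x => F x 0 j)) -> smooth_on W g ->
  smooth_on U (fun x => g (F x)).
Proof. by move=> oU UW CF Cg k; exact: (@Ck_comp _ _ _ _ W). Qed.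

Lemma smooth_on_local n (U : set 'rV[R]_n) (g : 'rV[R]_n -> R) :
  (forall y, U y -> exists W : set 'rV[R]_n, W y /\ smooth_on W g) ->
  smooth_on U g.
Proof.
move=> H k; apply: Ck_local => y Uy; have [W [Wy sW]] := H y Uy.
by exists W; split=> //; exact: sW.
Qed.

Lemma smooth_on_ext n (U : set 'rV[R]_n) (f g : 'rV[R]_n -> R) :
  open U -> (forall x, U x -> f x = g x) -> smooth_on U f -> smooth_on U g.
Proof. by move=> oU fg sf k; exact: Ck_ext oU fg (sf k). Qed.

End Calculus.
Section Charts.
Variables (R : realType) (n : nat) (T : Type).

(* [c_inv] is the inverse of [c_map] on the open set [c_cod]; its values
   elsewhere are irrelevant. *)
Record chart := Chart {
  c_dom : set T;
  c_map :> T -> 'rV[R]_n;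
  c_inv : 'rV[R]_n -> T;
  c_open : open (c_map @` c_dom);
  c_mapK : forall x, c_dom x -> c_inv (c_map x) = x
}.

Definition c_cod (c : chart) : set 'rV[R]_n := c @` c_dom c.

Definition smooth_transition (c d : chart) : Prop :=
  open (c @` (c_dom c `&` c_dom d)) /\
  forall i, smooth_on (c @` (c_dom c `&` c_dom d))
                      (fun y => d (c_inv c y) 0 i).

Definition chart_open (A : set chart) (U : set T) : Prop :=
  forall c, A c -> open (c @` (U `&` c_dom c)).

Record smooth_structure := SmoothStructure {
  atlas : set chart;
  atlas_cover : forall x, exists2 c, atlas c & c_dom c x;
  atlas_compat : forall c d, atlas c -> atlas d -> smooth_transition c d;
  atlas_maximal : forall c,
    (forall d, atlas d -> smooth_transition c d /\ smooth_transition d c) ->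
    atlas c;
  atlas_hausdorff : forall x y : T, x <> y -> exists U V : set T,
    [/\ chart_open atlas U, chart_open atlas V, U x, V y & U `&` V = set0];
  atlas_second_countable : exists B : nat -> set T,
    (forall i, chart_open atlas (B i)) /\
    (forall U x, chart_open atlas U -> U x ->
       exists i, B i x /\ B i `<=` U)
}.

Lemma c_codP (c : chart) y :
  c_cod c y -> c_dom c (c_inv c y) /\ c (c_inv c y) = y.
Proof. by move=> [x cx <-]; rewrite c_mapK. Qed.

Lemma c_cod_map (c : chart) x : c_dom c x -> c_cod c (c x).
Proof. by move=> cx; exists x. Qed.

End Charts.

Arguments c_open {R n T} c.

Record manifold (R : realType) (n : nat) := Manifold {
  mfd_sort :> Type;
  mfd_str : smooth_structure R n mfd_sort
}.

Definition charts (R : realType) n (N : manifold R n) : set (chart R n N) :=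
  atlas (mfd_str N).
Arguments charts {R n} N _.

Definition is_smooth (R : realType) n (N : manifold R n) (f : N -> R) : Prop :=
  forall c, charts N c -> smooth_on (c_cod c) (fun y => f (c_inv c y)).

Definition smooth_map (R : realType) n m (N : manifold R n) (P : manifold R m)
    (F : N -> P) : Prop :=
  forall x, exists c d, [/\ charts N c, charts P d, c_dom c x,
    (forall z, c_dom c z -> c_dom d (F z)) &
    forall i, smooth_on (c_cod c) (fun y => d (F (c_inv c y)) 0 i)].

Section Smooth_maps.
Variables (R : realType) (n : nat) (N : manifold R n).
Implicit Types (f g : N -> R).

Lemma is_smooth_cst (a : R) : is_smooth (fun _ : N => a).
Proof. by move=> c _ k; exact: Ck_cst. Qed.

Lemma is_smoothD f g :
  is_smooth f -> is_smooth g -> is_smooth (fun x => f x + g x).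
Proof.
move=> sf sg c Nc k; have := CkD (c_open c) (sf c Nc k) (sg c Nc k); exact.
Qed.

Lemma is_smoothM f g :
  is_smooth f -> is_smooth g -> is_smooth (fun x => f x * g x).
Proof.
move=> sf sg c Nc k; have := CkM (c_open c) (sf c Nc k) (sg c Nc k); exact.
Qed.

(* Changing chart: what is smooth in [d] is smooth in [c] near each point. *)
Lemma smooth_on_chart (c d : chart R n N) (g : 'rV[R]_n -> R) :
  charts N c -> charts N d -> smooth_on (c_cod d) g ->
  smooth_on (c @` (c_dom c `&` c_dom d)) (fun y => g (d (c_inv c y))).
Proof.
move=> Nc Nd sg; have [oW sW] := atlas_compat Nc Nd.
apply: (smooth_on_comp oW _ sW sg) => _ [z [cz dz] <-].
by rewrite c_mapK //; exact: c_cod_map.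
Qed.

Lemma is_smooth_comp m (P : manifold R m) (F : N -> P) (f : P -> R) :
  smooth_map F -> is_smooth f -> is_smooth (fun x => f (F x)).
Proof.
move=> sF sf c0 Nc0; apply: smooth_on_local => y /c_codP[cx cy].
have [c [d [Nc Pd cz cd sd]]] := sF (c_inv c0 y).
exists (c0 @` (c_dom c0 `&` c_dom c)); split; first by exists (c_inv c0 y).
have sfF : smooth_on (c_cod c) (fun z => f (c_inv d (d (F (c_inv c z))))).
  apply: (smooth_on_comp (c_open c) _ sd (sf d Pd)) => _ [z cz' <-].
  by rewrite c_mapK //; apply: c_cod_map; exact: cd.
apply: smooth_on_ext (smooth_on_chart Nc0 Nc sfF).
  by have [] := atlas_compat Nc0 Nc.
move=> _ [z [c0z cz'] <-]; rewrite (c_mapK c0z) (c_mapK cz').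
by rewrite c_mapK //; exact: cd.
Qed.

Lemma smooth_map_charts m (P : manifold R m) (F : N -> P) c d j :
  smooth_map F -> charts N c -> charts P d ->
  (forall x, c_dom c x -> c_dom d (F x)) ->
  smooth_on (c_cod c) (fun y => d (F (c_inv c y)) 0 j).
Proof.
move=> sF Nc Pd cd; apply: smooth_on_local => y /c_codP[cx cy].
have [c1 [d1 [Nc1 Pd1 c1x cd1 sd1]]] := sF (c_inv c y).
have [oW sW] := atlas_compat Nc Nc1.
have [oD sD] := atlas_compat Pd1 Pd.
exists (c @` (c_dom c `&` c_dom c1)); split; first by exists (c_inv c y).
have s1 i : smooth_on (c @` (c_dom c `&` c_dom c1))
    (fun z => d1 (F (c_inv c1 (c1 (c_inv c z)))) 0 i).
  exact: (smooth_on_chart Nc Nc1 (sd1 i)).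
apply: smooth_on_ext (smooth_on_comp oW _ s1 (sD j)) => //.
  move=> _ [z [cz c1z] <-]; rewrite (c_mapK cz) (c_mapK c1z).
  by rewrite c_mapK //; exact: cd1.
move=> _ [z [cz c1z] <-]; rewrite (c_mapK cz) (c_mapK c1z).
by exists (F z) => //; split; [exact: cd1|exact: cd].
Qed.

End Smooth_maps.
Section Function_algebra.
Variables (R : realType) (n : nat) (N : manifold R n).

Record Cinf := MkCinf { cinf_fun :> N -> R; cinfP : is_smooth cinf_fun }.

Lemma cinf_ext (f g : Cinf) : f =1 g -> f = g.
Proof.
case: f g => f sf [g sg] /= /funext E; case: _ / E in sg *.
by congr MkCinf; exact: Prop_irrelevance.
Qed.

HB.instance Definition _ := gen_eqMixin Cinf.
HB.instance Definition _ := gen_choiceMixin Cinf.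

Definition cinf_cst (a : R) : Cinf := MkCinf (@is_smooth_cst R n N a).
Definition cinf_add (f g : Cinf) : Cinf := MkCinf (is_smoothD (cinfP f) (cinfP g)).
Definition cinf_mul (f g : Cinf) : Cinf := MkCinf (is_smoothM (cinfP f) (cinfP g)).
Definition cinf_opp (f : Cinf) : Cinf := cinf_mul (cinf_cst (- 1)) f.

Let cinf_addA : associative cinf_add.
Proof. by move=> f g h; apply: cinf_ext => x /=; rewrite addrA. Qed.
Let cinf_addC : commutative cinf_add.
Proof. by move=> f g; apply: cinf_ext => x /=; rewrite addrC. Qed.
Let cinf_add0 : left_id (cinf_cst 0) cinf_add.
Proof. by move=> f; apply: cinf_ext => x /=; rewrite add0r. Qed.
Let cinf_addN : left_inverse (cinf_cst 0) cinf_opp cinf_add.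
Proof. by move=> f; apply: cinf_ext => x /=; rewrite mulN1r addNr. Qed.

HB.instance Definition _ :=
  GRing.isZmodule.Build Cinf cinf_addA cinf_addC cinf_add0 cinf_addN.

Let cinf_mulA : associative cinf_mul.
Proof. by move=> f g h; apply: cinf_ext => x /=; rewrite mulrA. Qed.
Let cinf_mulC : commutative cinf_mul.
Proof. by move=> f g; apply: cinf_ext => x /=; rewrite mulrC. Qed.
Let cinf_mul1 : left_id (cinf_cst 1) cinf_mul.
Proof. by move=> f; apply: cinf_ext => x /=; rewrite mul1r. Qed.
Let cinf_mulDl : left_distributive cinf_mul cinf_add.
Proof. by move=> f g h; apply: cinf_ext => x /=; rewrite mulrDl. Qed.

HB.instance Definition _ := GRing.Zmodule_isComPzRing.Build Cinf
  cinf_mulA cinf_mulC cinf_mul1 cinf_mulDl.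

Lemma cinfDE (f g : Cinf) x : (f + g) x = f x + g x. Proof. by []. Qed.
Lemma cinfME (f g : Cinf) x : (f * g) x = f x * g x. Proof. by []. Qed.
Lemma cinfNE (f : Cinf) x : (- f) x = - f x. Proof. exact: mulN1r. Qed.
Lemma cinf0E x : (0 : Cinf) x = 0. Proof. by []. Qed.
Lemma cinf1E x : (1 : Cinf) x = 1. Proof. by []. Qed.

End Function_algebra.

Section Linear_dual.
Variables (R : realType) (V : lmodType R).

Record dual := MkDual {
  dual_fun :> V -> R;
  dualP : forall a u v, dual_fun (a *: u + v) = a * dual_fun u + dual_fun v
}.

Lemma dual_ext (f g : dual) : f =1 g -> f = g.
Proof.
case: f g => f lf [g lg] /= /funext E; case: _ / E in lg *.
by congr MkDual; exact: Prop_irrelevance.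
Qed.

HB.instance Definition _ := gen_eqMixin dual.
HB.instance Definition _ := gen_choiceMixin dual.

Lemma dual_comb_subproof (c : R) (f g : dual) (a : R) (u v : V) :
  c * f (a *: u + v) + g (a *: u + v) =
  a * (c * f u + g u) + (c * f v + g v).
Proof. by rewrite !dualP !mulrDr !mulrA [c * a]mulrC addrACA. Qed.

Lemma dual0_subproof (a : R) (u v : V) : 0 = a * 0 + 0 :> R.
Proof. by rewrite mulr0 addr0. Qed.

Definition dual_comb (c : R) (f g : dual) : dual := MkDual (dual_comb_subproof c f g).
Definition dual0 : dual := MkDual dual0_subproof.

Let addA : associative (dual_comb 1).
Proof. by move=> f g h; apply: dual_ext => x /=; rewrite !mul1r addrA. Qed.
Let addC : commutative (dual_comb 1).
Proof. by move=> f g; apply: dual_ext => x /=; rewrite !mul1r addrC. Qed.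
Let add0 : left_id dual0 (dual_comb 1).
Proof. by move=> f; apply: dual_ext => x /=; rewrite mul1r add0r. Qed.
Let addN : left_inverse dual0 (dual_comb (- 1) ^~ dual0) (dual_comb 1).
Proof.
by move=> f; apply: dual_ext => x /=; rewrite mul1r mulN1r addr0 addNr.
Qed.

HB.instance Definition _ := GRing.isZmodule.Build dual addA addC add0 addN.

Let scale (c : R) (f : dual) : dual := dual_comb c f dual0.

Let scaleA a b f : scale a (scale b f) = scale (a * b) f.
Proof. by apply: dual_ext => x /=; rewrite !addr0 mulrA. Qed.
Let scale1 : left_id 1 scale.
Proof. by move=> f; apply: dual_ext => x /=; rewrite mul1r addr0. Qed.
Let scaleDr : right_distributive scale +%R.
Proof.
by move=> a f g; apply: dual_ext => x /=; rewrite !addr0 !mul1r mulrDr.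
Qed.
Let scaleDl f : {morph scale^~ f : a b / a + b}.
Proof.
by move=> a b; apply: dual_ext => x /=; rewrite !addr0 !mul1r mulrDl.
Qed.

HB.instance Definition _ :=
  GRing.Zmodule_isLmodule.Build R dual scaleA scale1 scaleDr scaleDl.

Lemma dualDE (f g : dual) u : (f + g) u = f u + g u.
Proof. by rewrite /= mul1r. Qed.
Lemma dualZE a (f : dual) u : (a *: f) u = a * f u.
Proof. by rewrite /= addr0. Qed.
Lemma dualNE (f : dual) u : (- f) u = - f u.
Proof. by rewrite /= mulN1r addr0. Qed.
Lemma dual0E u : (0 : dual) u = 0. Proof. by []. Qed.

Lemma dual_mapD (f : dual) u v : f (u + v) = f u + f v.
Proof. by rewrite -[u]scale1r dualP mul1r scale1r. Qed.
Lemma dual_map0 (f : dual) : f 0 = 0.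
Proof. by apply: (addrI (f 0)); rewrite -dual_mapD !addr0. Qed.
Lemma dual_mapZ (f : dual) a u : f (a *: u) = a * f u.
Proof. by rewrite -[a *: u]addr0 dualP dual_map0 addr0. Qed.
Lemma dual_mapN (f : dual) u : f (- u) = - f u.
Proof. by rewrite -scaleN1r dual_mapZ mulN1r. Qed.

End Linear_dual.

Section Tangent_space.
Variables (R : realType) (n : nat) (N : manifold R n) (p : N).

(* Tangent vectors at [p] are the derivations of the algebra [Cinf N] at [p]. *)
Record tangent := MkTangent {
  tan_fun :> Cinf N -> R;
  tan_linear : forall a f g,
    tan_fun (cinf_cst N a * f + g) = a * tan_fun f + tan_fun g;
  tan_leibniz : forall f g, tan_fun (f * g) = f p * tan_fun g + g p * tan_fun f
}.

Lemma tangent_ext (v w : tangent) : v =1 w -> v = w.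
Proof.
case: v w => v lv dv [w lw dw] /= /funext E; case: _ / E in lw dw *.
by congr MkTangent; exact: Prop_irrelevance.
Qed.

HB.instance Definition _ := gen_eqMixin tangent.
HB.instance Definition _ := gen_choiceMixin tangent.

Lemma tan_comb_linear_subproof (c : R) (v w : tangent) (a : R) (f g : Cinf N) :
  c * v (cinf_cst N a * f + g) + w (cinf_cst N a * f + g) =
  a * (c * v f + w f) + (c * v g + w g).
Proof. by rewrite !tan_linear !mulrDr !mulrA [c * a]mulrC addrACA. Qed.

Lemma tan_comb_leibniz_subproof (c : R) (v w : tangent) (f g : Cinf N) :
  c * v (f * g) + w (f * g) =
  f p * (c * v g + w g) + g p * (c * v f + w f).
Proof.
by rewrite !tan_leibniz !mulrDr !mulrA [f p * c]mulrC [g p * c]mulrC addrACA.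
Qed.

Lemma tan0_linear_subproof (a : R) (f g : Cinf N) : 0 = a * 0 + 0 :> R.
Proof. by rewrite mulr0 addr0. Qed.

Lemma tan0_leibniz_subproof (f g : Cinf N) : 0 = f p * 0 + g p * 0 :> R.
Proof. by rewrite !mulr0 addr0. Qed.

Definition tan_comb (c : R) (v w : tangent) : tangent :=
  MkTangent (tan_comb_linear_subproof c v w) (tan_comb_leibniz_subproof c v w).
Definition tan0 : tangent := MkTangent tan0_linear_subproof tan0_leibniz_subproof.

Let addA : associative (tan_comb 1).
Proof. by move=> f g h; apply: tangent_ext => x /=; rewrite !mul1r addrA. Qed.
Let addC : commutative (tan_comb 1).
Proof. by move=> f g; apply: tangent_ext => x /=; rewrite !mul1r addrC. Qed.
Let add0 : left_id tan0 (tan_comb 1).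
Proof. by move=> f; apply: tangent_ext => x /=; rewrite mul1r add0r. Qed.
Let addN : left_inverse tan0 (tan_comb (- 1) ^~ tan0) (tan_comb 1).
Proof.
by move=> f; apply: tangent_ext => x /=; rewrite mul1r mulN1r addr0 addNr.
Qed.

HB.instance Definition _ := GRing.isZmodule.Build tangent addA addC add0 addN.

Let scale (c : R) (f : tangent) : tangent := tan_comb c f tan0.

Let scaleA a b f : scale a (scale b f) = scale (a * b) f.
Proof. by apply: tangent_ext => x /=; rewrite !addr0 mulrA. Qed.
Let scale1 : left_id 1 scale.
Proof. by move=> f; apply: tangent_ext => x /=; rewrite mul1r addr0. Qed.
Let scaleDr : right_distributive scale +%R.
Proof.
by move=> a f g; apply: tangent_ext => x /=; rewrite !addr0 !mul1r mulrDr.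
Qed.
Let scaleDl f : {morph scale^~ f : a b / a + b}.
Proof.
by move=> a b; apply: tangent_ext => x /=; rewrite !addr0 !mul1r mulrDl.
Qed.

HB.instance Definition _ :=
  GRing.Zmodule_isLmodule.Build R tangent scaleA scale1 scaleDr scaleDl.

Lemma tanDE (v w : tangent) f : (v + w) f = v f + w f.
Proof. by rewrite /= mul1r. Qed.
Lemma tanZE a (v : tangent) f : (a *: v) f = a * v f.
Proof. by rewrite /= addr0. Qed.
Lemma tanNE (v : tangent) f : (- v) f = - v f.
Proof. by rewrite /= mulN1r addr0. Qed.
Lemma tan0E f : (0 : tangent) f = 0. Proof. by []. Qed.

Lemma tan_mapD (v : tangent) f g : v (f + g) = v f + v g.
Proof.
by rewrite -[f in LHS]mul1r (tan_linear v 1) mul1r.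
Qed.
Lemma tan_map0 (v : tangent) : v 0 = 0.
Proof. by apply: (addrI (v 0)); rewrite -tan_mapD !addr0. Qed.
Lemma tan_mapN (v : tangent) f : v (- f) = - v f.
Proof. by apply: (addrI (v f)); rewrite -tan_mapD !subrr tan_map0. Qed.

End Tangent_space.

(* A family of vector spaces over [N] together with its smooth sections.  Below,
   a section [X] of TN is smooth when [X f] is smooth for all smooth [f], and a
   section of T^*N when its values on all smooth vector fields are smooth. *)
Record family (R : realType) (n : nat) (N : manifold R n) := Family {
  fiber :> N -> lmodType R;
  smooth_section : (forall p, fiber p) -> Prop;
  smooth_section0 : smooth_section (fun=> 0);
  smooth_section_comb : forall (f : Cinf N) s t,
    smooth_section s -> smooth_section t ->
    smooth_section (fun p => f p *: s p + t p)
}.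

Section Sections.
Variables (R : realType) (n : nat) (N : manifold R n) (F : family N).

Record Gamma := MkGamma {
  gamma_fun :> forall p, F p;
  gammaP : smooth_section gamma_fun
}.

Lemma gamma_ext (s t : Gamma) : (forall p, s p = t p) -> s = t.
Proof.
case: s t => s ss [t st] /= H.
have E : s = t by apply: functional_extensionality_dep.
by subst t; congr MkGamma; exact: Prop_irrelevance.
Qed.

HB.instance Definition _ := gen_eqMixin Gamma.
HB.instance Definition _ := gen_choiceMixin Gamma.

Definition gamma_comb (f : Cinf N) (s t : Gamma) : Gamma :=
  MkGamma (smooth_section_comb f (gammaP s) (gammaP t)).
Definition gamma0 : Gamma := MkGamma (smooth_section0 F).

Let addA : associative (gamma_comb 1).
Proof. by move=> f g h; apply: gamma_ext => x /=; rewrite !scale1r addrA. Qed.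
Let addC : commutative (gamma_comb 1).
Proof. by move=> f g; apply: gamma_ext => x /=; rewrite !scale1r addrC. Qed.
Let add0 : left_id gamma0 (gamma_comb 1).
Proof. by move=> f; apply: gamma_ext => x /=; rewrite scale1r add0r. Qed.
Let addN : left_inverse gamma0 (gamma_comb (- 1) ^~ gamma0) (gamma_comb 1).
Proof.
move=> f; apply: gamma_ext => x /=.
by rewrite scale1r addr0 mulr1 scaleN1r addNr.
Qed.

HB.instance Definition _ := GRing.isZmodule.Build Gamma addA addC add0 addN.

Let scale (f : Cinf N) (s : Gamma) : Gamma := gamma_comb f s gamma0.

Let scaleA a b f : scale a (scale b f) = scale (a * b) f.
Proof. by apply: gamma_ext => x /=; rewrite !addr0 scalerA. Qed.
Let scale1 : left_id 1 scale.
Proof. by move=> f; apply: gamma_ext => x /=; rewrite scale1r addr0. Qed.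
Let scaleDr : right_distributive scale +%R.
Proof.
by move=> a f g; apply: gamma_ext => x /=; rewrite !addr0 !scale1r scalerDr.
Qed.
Let scaleDl f : {morph scale^~ f : a b / a + b}.
Proof.
by move=> a b; apply: gamma_ext => x /=; rewrite !addr0 !scale1r scalerDl.
Qed.

HB.instance Definition _ :=
  GRing.Zmodule_isLmodule.Build (Cinf N) Gamma scaleA scale1 scaleDr scaleDl.

Lemma gammaDE (s t : Gamma) p : (s + t) p = s p + t p.
Proof. by rewrite /= scale1r. Qed.
Lemma gammaZE (f : Cinf N) (s : Gamma) p : (f *: s) p = f p *: s p.
Proof. by rewrite /= addr0. Qed.
Lemma gammaNE (s : Gamma) p : (- s) p = - s p.
Proof. by rewrite /= addr0 mulr1 scaleN1r. Qed.
Lemma gamma0E p : (0 : Gamma) p = 0. Proof. by []. Qed.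

End Sections.
Section Tangent_bundle.
Variables (R : realType) (n : nat) (N : manifold R n).

Definition smooth_vfield (X : forall p : N, tangent p) : Prop :=
  forall f : Cinf N, is_smooth (fun p => X p f).

Lemma smooth_vfield0 : smooth_vfield (fun=> 0).
Proof. by move=> f; exact: is_smooth_cst. Qed.

Lemma smooth_vfield_comb (g : Cinf N) (X Y : forall p : N, tangent p) :
  smooth_vfield X -> smooth_vfield Y ->
  smooth_vfield (fun p => g p *: X p + Y p).
Proof.
move=> sX sY f.
have -> : (fun p => (g p *: X p + Y p) f) = (fun p => g p * X p f + Y p f).
  by apply/funext => p; rewrite tanDE tanZE.
by apply: is_smoothD => //; apply: is_smoothM => //; exact: cinfP.
Qed.

Definition tangent_bundle : family N := @Family R n N (fun p => tangent p : lmodType R)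
  smooth_vfield smooth_vfield0 smooth_vfield_comb.

Definition vf_app (X : Gamma tangent_bundle) (f : Cinf N) : Cinf N := MkCinf (gammaP X f).

Definition smooth_form (theta : forall p : N, dual (tangent p)) : Prop :=
  forall X : Gamma tangent_bundle, is_smooth (fun p => theta p (X p)).

Lemma smooth_form0 : smooth_form (fun=> 0).
Proof. by move=> X; exact: is_smooth_cst. Qed.

Lemma smooth_form_comb (g : Cinf N) (s t : forall p : N, dual (tangent p)) :
  smooth_form s -> smooth_form t -> smooth_form (fun p => g p *: s p + t p).
Proof.
move=> ss st X.
have -> : (fun p => (g p *: s p + t p) (X p)) =
    (fun p => g p * s p (X p) + t p (X p)).
  by apply/funext => p; rewrite dualDE dualZE.
by apply: is_smoothD => //; apply: is_smoothM => //; exact: cinfP.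
Qed.

Definition cotangent_bundle : family N :=
  @Family R n N (fun p => dual (tangent p) : lmodType R)
    smooth_form smooth_form0 smooth_form_comb.

Definition form_app (theta : Gamma cotangent_bundle) (X : Gamma tangent_bundle) : Cinf N :=
  MkCinf (gammaP theta X).

Lemma vf_appE X f p : vf_app X f p = X p f. Proof. by []. Qed.
Lemma form_appE th X p : form_app th X p = th p (X p). Proof. by []. Qed.
Lemma vf_appD X f g : vf_app X (f + g) = vf_app X f + vf_app X g.
Proof. by apply: cinf_ext => p; rewrite cinfDE !vf_appE tan_mapD. Qed.
Lemma vf_appN X f : vf_app X (- f) = - vf_app X f.
Proof. by apply: cinf_ext => p; rewrite cinfNE !vf_appE tan_mapN. Qed.
Lemma vf_appM X f g : vf_app X (f * g) = f * vf_app X g + g * vf_app X f.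
Proof. by apply: cinf_ext => p; rewrite cinfDE !cinfME !vf_appE tan_leibniz. Qed.
Lemma vf_appDl X Y f : vf_app (X + Y) f = vf_app X f + vf_app Y f.
Proof. by apply: cinf_ext => p; rewrite cinfDE !vf_appE gammaDE tanDE. Qed.
Lemma vf_appZl g X f : vf_app (g *: X) f = g * vf_app X f.
Proof. by apply: cinf_ext => p; rewrite cinfME !vf_appE gammaZE tanZE. Qed.
Lemma form_appD th X Y : form_app th (X + Y) = form_app th X + form_app th Y.
Proof. by apply: cinf_ext => p; rewrite cinfDE !form_appE gammaDE dual_mapD. Qed.
Lemma form_appZ th f X : form_app th (f *: X) = f * form_app th X.
Proof. by apply: cinf_ext => p; rewrite cinfME !form_appE gammaZE dual_mapZ. Qed.

Section Lie_bracket.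
Variables (X Y : Gamma tangent_bundle).

Lemma lie_linear_subproof p a f g :
  (fun f => X p (vf_app Y f) - Y p (vf_app X f)) (cinf_cst N a * f + g) =
  a * (fun f => X p (vf_app Y f) - Y p (vf_app X f)) f +
  (fun f => X p (vf_app Y f) - Y p (vf_app X f)) g.
Proof.
have E (Z : Gamma tangent_bundle) : vf_app Z (cinf_cst N a * f + g) =
    cinf_cst N a * vf_app Z f + vf_app Z g.
  by apply: cinf_ext => q /=; rewrite tan_linear.
by rewrite /= !E !tan_linear mulrBr opprD addrACA.
Qed.

Lemma lie_leibniz_subproof p f g :
  (fun f => X p (vf_app Y f) - Y p (vf_app X f)) (f * g) =
  f p * (fun f => X p (vf_app Y f) - Y p (vf_app X f)) g +
  g p * (fun f => X p (vf_app Y f) - Y p (vf_app X f)) f.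
Proof.
rewrite /= !vf_appM !tan_mapD !tan_leibniz /= !mulrBr !opprD.
set a := f p * _; set b := Y p g * _; set c := g p * _; set d := Y p f * _.
set e := f p * _; set h := X p g * _; set i := g p * _; set j := X p f * _.
have -> : h = d by rewrite /h /d mulrC.
have -> : j = b by rewrite /j /b mulrC.
by ring.
Qed.

Definition lie_at (p : N) : tangent p :=
  MkTangent (lie_linear_subproof p) (lie_leibniz_subproof p).

Lemma lie_smooth : smooth_vfield lie_at.
Proof.
move=> f; have := cinfP (vf_app X (vf_app Y f) - vf_app Y (vf_app X f)).
by congr is_smooth; apply/funext => p; rewrite cinfDE cinfNE.
Qed.

Definition lie : Gamma tangent_bundle := @MkGamma _ _ _ tangent_bundle lie_at lie_smooth.

End Lie_bracket.

Lemma lieE X Y f :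
  vf_app (lie X Y) f = vf_app X (vf_app Y f) - vf_app Y (vf_app X f).
Proof. by apply: cinf_ext => p; rewrite cinfDE cinfNE. Qed.

Lemma lieDr X Y Z : lie X (Y + Z) = lie X Y + lie X Z.
Proof.
apply: gamma_ext => p; apply: tangent_ext => f.
rewrite gammaDE tanDE -!vf_appE !lieE !vf_appDl vf_appD.
by rewrite -[RHS]cinfDE opprD addrACA.
Qed.

Lemma lieZr X f Y : lie X (f *: Y) = f *: lie X Y + vf_app X f *: Y.
Proof.
apply: gamma_ext => p; apply: tangent_ext => g.
rewrite gammaDE !gammaZE tanDE !tanZE -!vf_appE !lieE !vf_appZl vf_appM.
by rewrite -!cinfME -cinfDE; congr (cinf_fun _ p); ring.
Qed.

(* Differential 1-forms as [Cinf N]-linear maps on vector fields. *)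
Definition form : Type := {linear Gamma tangent_bundle -> (Cinf N)^o}.

Section Form_of_section.
Variable theta : Gamma cotangent_bundle.
Let fs (X : Gamma tangent_bundle) : (Cinf N)^o := form_app theta X.
Let fs_linear : linear fs.
Proof. by move=> f X Y; rewrite /fs form_appD form_appZ. Qed.
HB.instance Definition _ := GRing.isLinear.Build _ _ _ _ fs fs_linear.
Definition form_of : form := fs.
End Form_of_section.

Definition lie_deriv (U : Gamma tangent_bundle) (beta : Gamma cotangent_bundle) (W : Gamma tangent_bundle) : Cinf N :=
  vf_app U (form_app beta W) - form_app beta (lie U W).

Definition dform (alpha : Gamma cotangent_bundle) (V W : Gamma tangent_bundle) : Cinf N :=
  vf_app V (form_app alpha W) - vf_app W (form_app alpha V)
  - form_app alpha (lie V W).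

Section Courant_Dorfman.
Variables chi1 chi2 : (Gamma tangent_bundle * Gamma cotangent_bundle)%type.

Let cd (W : Gamma tangent_bundle) : (Cinf N)^o :=
  lie_deriv chi1.1 chi2.2 W - dform chi1.2 chi2.1 W.

Let cd_linear : linear cd.
Proof.
move=> f X Y; rewrite /cd /lie_deriv /dform.
rewrite !lieDr !lieZr !form_appD !form_appZ !vf_appD !vf_appM !vf_appDl !vf_appZl.
rewrite -[f *: _]/(f * _).
by ring.
Qed.
HB.instance Definition _ := GRing.isLinear.Build _ _ _ _ cd cd_linear.

Definition courant_dorfman : (Gamma tangent_bundle * form)%type :=
  (lie chi1.1 chi2.1, cd : form).

End Courant_Dorfman.

End Tangent_bundle.
Arguments tangent_bundle {R n} N.
Arguments cotangent_bundle {R n} N.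
Section Pushforward.
Variables (R : realType) (n m : nat) (N : manifold R n) (P : manifold R m).
Variables (F : N -> P) (sF : smooth_map F).

Definition pullback_fun (f : Cinf P) : Cinf N :=
  MkCinf (is_smooth_comp sF (cinfP f)).

Lemma push_linear_subproof p (v : tangent p) a f g :
  v (pullback_fun (cinf_cst P a * f + g)) =
  a * v (pullback_fun f) + v (pullback_fun g).
Proof. by rewrite -tan_linear; congr (v _); exact: cinf_ext. Qed.

Lemma push_leibniz_subproof p (v : tangent p) f g :
  v (pullback_fun (f * g)) =
  f (F p) * v (pullback_fun g) + g (F p) * v (pullback_fun f).
Proof.
have -> : pullback_fun (f * g) = pullback_fun f * pullback_fun g.
  exact: cinf_ext.
by rewrite tan_leibniz.
Qed.

Definition push p (v : tangent p) : tangent (F p) :=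
  MkTangent (push_linear_subproof v) (push_leibniz_subproof v).

Lemma pull_covector_subproof p (th : dual (tangent (F p))) a (u v : tangent p) :
  th (push (a *: u + v)) = a * th (push u) + th (push v).
Proof.
rewrite -dualP; congr (th _); apply: tangent_ext => f.
by rewrite tanDE tanZE /= mul1r addr0.
Qed.

Definition pull_covector p (th : dual (tangent (F p))) : dual (tangent p) :=
  MkDual (pull_covector_subproof th).

End Pushforward.

Section Differential.
Variables (R : realType) (n : nat) (N : manifold R n).

Lemma dfun_subproof (f : Cinf N) p a (u v : tangent p) :
  (a *: u + v) f = a * u f + v f.
Proof. by rewrite tanDE tanZE. Qed.

Definition dfun (f : Cinf N) (p : N) : dual (tangent p) :=
  MkDual (dfun_subproof f (p := p)).

End Differential.

(* [d] is the chart (x, v) |-> (c x, h_x v) of the total space, defined over the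
   domain of [c], where the [h_x] are linear isomorphisms. *)
Definition bundle_chart (R : realType) n k (M : manifold R n)
    (fib : M -> lmodType R) (c : chart R n M) (h : forall x, fib x -> 'rV[R]_k)
    (d : chart R (n + k) {x : M & fib x}) : Prop :=
  [/\ forall x, c_dom c x -> linear (h x) /\ bijective (h x),
      forall p, c_dom d p <-> c_dom c (projT1 p) &
      forall p, c_dom d p -> d p = row_mx (c (projT1 p)) (h _ (projT2 p))].

Record vbundle (R : realType) (n : nat) (M : manifold R n) (k : nat) := VBundle {
  vb_fib :> M -> lmodType R;
  vb_str : smooth_structure R (n + k) {x : M & vb_fib x};
  vb_triv : forall x : M, exists c h d,
    [/\ charts M c, c_dom c x, atlas vb_str d & bundle_chart (fib := vb_fib) c h d]
}.

Section Vector_bundle.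
Variables (R : realType) (n k : nat) (M : manifold R n) (E : vbundle M k).

Definition tot : manifold R (n + k) := Manifold (vb_str E).
Definition pt (m : M) (a : E m) : tot := existT _ m a.
Definition qE (p : tot) : M := projT1 p.

Lemma bundle_chart_inv (c : chart R n M) (h : forall x, E x -> 'rV[R]_k)
    (d : chart R (n + k) tot) y : bundle_chart (fib := E) c h d -> c_cod d y ->
  [/\ c_dom c (qE (c_inv d y)), c (qE (c_inv d y)) = lsubmx y &
      h _ (projT2 (c_inv d y)) = rsubmx y].
Proof.
move=> [_ dc dE] /c_codP[dy]; rewrite dE // => Ey; split.
- exact/dc.
- by rewrite -[in RHS]Ey row_mxKl.
- by rewrite -[in RHS]Ey row_mxKr.
Qed.

Lemma qE_smooth : smooth_map qE.
Proof.
move=> p; have [c [h [d [Mc cp Ed B]]]] := vb_triv E (qE p).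
exists d, c; split=> //; try by have [_ + _] := B; move=> H; apply/H.
  by have [_ H _] := B; move=> z /H.
move=> i; apply: (@smooth_on_ext _ _ _ (fun y => y 0 (lshift k i))) => [|y cy|j].
- exact: c_open.
- by have [_ -> _] := bundle_chart_inv B cy; rewrite mxE.
- exact: Ck_coord.
Qed.

Definition smooth_vbsection (s : forall m, E m) : Prop :=
  smooth_map (fun m => pt (s m)).

Lemma vbsection_local (s : forall m, E m) (c : chart R n M)
    (h : forall x, E x -> 'rV[R]_k) (d : chart R (n + k) tot) j :
  charts M c -> atlas (vb_str E) d -> bundle_chart (fib := E) c h d ->
  smooth_vbsection s ->
  smooth_on (c_cod c) (fun y => h (c_inv c y) (s (c_inv c y)) 0 j).
Proof.
move=> Mc Ed B ss; have [_ dc dE] := B.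
have := @smooth_map_charts _ _ _ _ _ _ c d (rshift n j) ss Mc Ed.
move=> H; apply: smooth_on_ext (H _) => //.
- exact: c_open.
- by move=> y /c_codP[cy _]; rewrite dE /= ?row_mxEr//; exact/dc.
- by move=> x cx; apply/dc.
Qed.

Lemma vbsection_of_local (s : forall m, E m) :
  (forall (c : chart R n M) (h : forall x, E x -> 'rV[R]_k)
      (d : chart R (n + k) tot), charts M c -> atlas (vb_str E) d ->
     bundle_chart (fib := E) c h d -> forall j,
     smooth_on (c_cod c) (fun y => h (c_inv c y) (s (c_inv c y)) 0 j)) ->
  smooth_vbsection s.
Proof.
move=> H x; have [c [h [d [Mc cx Ed B]]]] := vb_triv E x.
have [_ dc dE] := B.
exists c, d; split=> //; first by move=> z cz; apply/dc.
move=> i; case: (splitP i) => j ij.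
  have -> : i = lshift k j by exact: val_inj.
  apply: (@smooth_on_ext _ _ _ (fun y => y 0 j)) => [|y /c_codP[cy Ey]|l].
  - exact: c_open.
  - by rewrite dE /= ?row_mxEl ?Ey//; exact/dc.
  - exact: Ck_coord.
have -> : i = rshift n j by exact: val_inj.
apply: smooth_on_ext (H c h d Mc Ed B j).
- exact: c_open.
- by move=> y /c_codP[cy _]; rewrite dE /= ?row_mxEr//; exact/dc.
Qed.

Lemma smooth_vbsection0 : smooth_vbsection (fun=> 0).
Proof.
apply: vbsection_of_local => c h d Mc Ed [hlin _ _] j l.
apply: Ck_ext (Ck_cst l (c_cod c) 0); first exact: c_open.
move=> y /c_codP[cy _]; have [lin _] := hlin _ cy.
have h0 : h (c_inv c y) 0 = 0.
  by apply: (addrI (h (c_inv c y) 0)); rewrite -{1}[h _ 0]scale1r -lin scaler0 !addr0.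
by rewrite h0 mxE.
Qed.

Lemma smooth_vbsection_comb (f : Cinf M) (s t : forall m, E m) :
  smooth_vbsection s -> smooth_vbsection t ->
  smooth_vbsection (fun p => f p *: s p + t p).
Proof.
move=> ss st; apply: vbsection_of_local => c h d Mc Ed B j l.
have oc : open (c_cod c) by exact: c_open.
have Cs := vbsection_local j Mc Ed B ss l.
have Ct := vbsection_local j Mc Ed B st l.
have Cf := cinfP f Mc l.
apply: Ck_ext (CkD oc (CkM oc Cf Cs) Ct) => // y /c_codP[cy _].
by have [hlin _ _] := B; have [lin _] := hlin _ cy; rewrite lin !mxE.
Qed.

Definition bundle_sections : family M := @Family R n M (vb_fib E)
  smooth_vbsection smooth_vbsection0 smooth_vbsection_comb.

(* A section of the dual bundle is smooth when the corresponding fibrewise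
   linear function on the total space is. *)
Definition smooth_dualsection (eps : forall m, dual (E m)) : Prop :=
  @is_smooth R (n + k) tot (fun p => eps (projT1 p) (projT2 p)).

Lemma smooth_dualsection0 : smooth_dualsection (fun=> 0).
Proof. exact: is_smooth_cst. Qed.

Lemma smooth_dualsection_comb (f : Cinf M) (s t : forall m, dual (E m)) :
  smooth_dualsection s -> smooth_dualsection t ->
  smooth_dualsection (fun p => f p *: s p + t p).
Proof.
move=> ss st; rewrite /smooth_dualsection.
have -> : (fun p : tot => (f (projT1 p) *: s (projT1 p) + t (projT1 p)) (projT2 p)) =
    (fun p : tot => f (qE p) * s (projT1 p) (projT2 p) + t (projT1 p) (projT2 p)).
  by apply/funext => p; rewrite dualDE dualZE.
apply: is_smoothD => //; apply: is_smoothM => //.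
by apply: is_smooth_comp; [exact: qE_smooth|exact: cinfP].
Qed.

Definition dual_bundle : family M := @Family R n M (fun m => dual (E m) : lmodType R)
  smooth_dualsection smooth_dualsection0 smooth_dualsection_comb.

Definition ell (eps : Gamma dual_bundle) : Cinf tot := MkCinf (gammaP eps : @is_smooth _ _ tot _).

Definition sec_map (e : Gamma bundle_sections) (m : M) : tot := pt (e m).
Lemma sec_smooth (e : Gamma bundle_sections) : smooth_map (sec_map e).
Proof. exact: gammaP e. Qed.

Lemma fiber_line_derivable (p : tot) (b : E (qE p)) (f : Cinf tot) :
  derivable (fun t : R => f (pt (projT2 p + t *: b))) 0 1.
Proof.
case: p b => m a b /=.
have [c [h [d [Mc cm Ed B]]]] := vb_triv E m.
have [hlin dc dE] := B; have [lin _] := hlin m cm.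
pose G (t : R) : 'rV[R]_(n + k) := row_mx (c m) (h m a) + t *: row_mx 0 (h m b).
have dom t : c_dom d (pt (a + t *: b)) by apply/dc.
have EG t : d (pt (a + t *: b)) = G t.
  by rewrite dE //= [a + _]addrC lin /G scale_row_mx add_row_mx scaler0 addr0 addrC.
have -> : (fun t : R => f (pt (a + t *: b))) = (fun y => f (c_inv d y)) \o G.
  by apply/funext => t /=; rewrite -EG c_mapK.
apply/derivable1_diffP; apply: differentiable_comp.
  apply: differentiableD; first exact: differentiable_cst.
  exact: differentiableZl.
have [+ _] := cinfP f Ed 1%N; apply.
by rewrite -EG; exact: c_cod_map.
Qed.

(* The vertical vector d/dt|_{t=0} (p + t b). *)
Definition vert_fun (p : tot) (b : E (qE p)) (f : Cinf tot) : R :=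
  'D_1 (fun t : R => f (pt (projT2 p + t *: b))) 0.

Lemma vert_linear_subproof (p : tot) (b : E (qE p)) a (f g : Cinf tot) :
  vert_fun b (cinf_cst tot a * f + g) = a * vert_fun b f + vert_fun b g.
Proof.
have df := @fiber_line_derivable p b f; have dg := @fiber_line_derivable p b g.
rewrite /vert_fun.
have Efg : (fun t : R => (cinf_cst tot a * f + g) (pt (projT2 p + t *: b))) =
    (cst a * (fun t => f (pt (projT2 p + t *: b)))) + (fun t => g (pt (projT2 p + t *: b))) by [].
have da := @derivable_cst R R R a 0 1.
by rewrite Efg (deriveD (derivableM da df) dg) (deriveM da df) derive_cst scaler0 addr0.
Qed.

Lemma vert_leibniz_subproof (p : tot) (b : E (qE p)) (f g : Cinf tot) :
  vert_fun b (f * g) = f p * vert_fun b g + g p * vert_fun b f.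
Proof.
have df := @fiber_line_derivable p b f; have dg := @fiber_line_derivable p b g.
rewrite /vert_fun [LHS](deriveM df dg).
have -> : pt (projT2 p + 0 *: b) = p by rewrite scale0r addr0; case: (p).
by [].
Qed.

Definition vert (p : tot) (b : E (qE p)) : tangent p :=
  MkTangent (vert_linear_subproof b) (vert_leibniz_subproof b).

End Vector_bundle.
Section Dorfman_brackets.
Variables (R : realType) (n k : nat) (M : manifold R n) (E : vbundle M k).

(* Sections of the direct sums of TM and E^*, of E and T^*M, and of TE and T^*E
   are pairs of sections. *)
Definition sec_TM_Edual : Type := (Gamma (tangent_bundle M) * Gamma (dual_bundle E))%type.
Definition sec_E_TdualM : Type := (Gamma (bundle_sections E) * Gamma (cotangent_bundle M))%type.
Definition sec_TE_TdualE : Type := (Gamma (tangent_bundle (tot E)) * Gamma (cotangent_bundle (tot E)))%type.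


Definition pairing (nu : sec_TM_Edual) (tau : sec_E_TdualM) : Cinf M :=
  pullback_fun (sec_smooth tau.1) (ell nu.2) + form_app tau.2 nu.1.

Lemma pairingE nu tau m :
  pairing nu tau m = nu.2 m (tau.1 m) + tau.2 m (nu.1 m).
Proof. by []. Qed.

Definition bracket : Type := sec_TM_Edual -> sec_TM_Edual -> sec_TM_Edual.

Definition R_bilinear (br : bracket) : Prop :=
  (forall (a : R) nu1 nu1' nu2,
     br (cinf_cst M a *: nu1 + nu1') nu2 =
     cinf_cst M a *: br nu1 nu2 + br nu1' nu2) /\
  (forall (a : R) nu1 nu2 nu2',
     br nu1 (cinf_cst M a *: nu2 + nu2') =
     cinf_cst M a *: br nu1 nu2 + br nu1 nu2').

Definition anchored (br : bracket) : Prop :=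
  forall nu1 nu2, (br nu1 nu2).1 = lie nu1.1 nu2.1.

Definition leibniz2 (br : bracket) : Prop :=
  forall nu1 (f : Cinf M) nu2,
    br nu1 (f *: nu2) = f *: br nu1 nu2 + vf_app nu1.1 f *: nu2.

Definition jacobi (br : bracket) : Prop :=
  forall nu1 nu2 nu3,
    br nu1 (br nu2 nu3) = br (br nu1 nu2) nu3 + br nu2 (br nu1 nu3).

Definition dorfman_bracket (br : bracket) : Prop :=
  [/\ R_bilinear br, anchored br, leibniz2 br & jacobi br].

Definition derivation_with_symbol (X : Gamma (tangent_bundle M)) (D : sec_E_TdualM -> sec_E_TdualM) : Prop :=
  (forall (a : R) tau tau',
     D (cinf_cst M a *: tau + tau') = cinf_cst M a *: D tau + D tau') /\
  (forall (f : Cinf M) tau, D (f *: tau) = f *: D tau + vf_app X f *: tau).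

Definition dual_derivation (br : bracket) (nu : sec_TM_Edual) (D : sec_E_TdualM -> sec_E_TdualM) : Prop :=
  derivation_with_symbol nu.1 D /\
  forall nu' tau,
    vf_app nu.1 (pairing nu' tau) = pairing nu' (D tau) + pairing (br nu nu') tau.

Definition core_lift (tau : sec_E_TdualM) (p : tot E) :
    (tangent p * dual (tangent p))%type :=
  (vert (tau.1 (qE p)), pull_covector (@qE_smooth _ _ _ _ E) (tau.2 (qE p))).

(* [z = lam v +_{TM} w] in the vector bundle TE -> TM, whose structure maps are
   the tangent maps of those of E -> M: [v], [w] and [z] are the velocities of
   curves s1, s2 and lam s1 + s2 in E over a common base curve. *)
Definition TM_comb (lam : R) (m : M) (a b : E m)
    (v : tangent (pt a)) (w : tangent (pt b)) (z : tangent (pt (lam *: a + b))) :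
    Prop :=
  exists (g : R -> M) (s1 s2 : forall t, E (g t)),
    [/\ pt (s1 0) = pt a, pt (s2 0) = pt b &
    forall f : Cinf (tot E),
      [/\ is_derive (0 : R) (1 : R) (fun t => f (pt (s1 t))) (v f),
          is_derive (0 : R) (1 : R) (fun t => f (pt (s2 t))) (w f) &
          is_derive (0 : R) (1 : R) (fun t => f (pt (lam *: s1 t + s2 t))) (z f)]].

(* [chi] is a vector bundle morphism over [nu] from E -> M to
   TE (+) T^*E -> TM (+) E^*: it covers [nu] with respect to (Tq_E, r_E), and on
   each fibre it is linear for the operations over TM and over E^*. *)
Definition linear_over (nu : sec_TM_Edual) (chi : sec_TE_TdualE) : Prop :=
  [/\ forall p : tot E, push (@qE_smooth _ _ _ _ E) (chi.1 p) = nu.1 (qE p),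
      forall (p : tot E) (b : E (qE p)), chi.2 p (vert b) = nu.2 (qE p) b,
      forall lam m (a b : E m),
        TM_comb (chi.1 (pt a)) (chi.1 (pt b)) (chi.1 (pt (lam *: a + b))) &
      forall lam m (a b : E m) (v : tangent (pt a)) (w : tangent (pt b))
          (z : tangent (pt (lam *: a + b))),
        TM_comb v w z ->
        chi.2 (pt (lam *: a + b)) z = lam * chi.2 (pt a) v + chi.2 (pt b) w].

Record linear_section := LinearSection {
  lin_sec :> sec_TE_TdualE;
  lin_secP : exists nu, linear_over nu lin_sec
}.

Definition sec_at (chi : sec_TE_TdualE) (p : tot E) :
    (tangent p * dual (tangent p))%type := (chi.1 p, chi.2 p).

Definition vform_of (chi : sec_TE_TdualE) : (Gamma (tangent_bundle (tot E)) * form (tot E))%type :=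
  (chi.1, form_of chi.2).

Definition lift_of (br : bracket) (Xi : sec_TM_Edual -> linear_section) : Prop :=
  exists D : sec_TM_Edual -> sec_E_TdualM -> sec_E_TdualM,
    (forall nu, dual_derivation br nu (D nu)) /\
    forall (nu : sec_TM_Edual) (e : Gamma (bundle_sections E)) (m : M),
      let p := sec_map e m in
      sec_at (Xi nu) p =
      (push (sec_smooth e) (nu.1 m), dfun (ell nu.2) p) - core_lift (D nu (e, 0)) p.

Definition natural_lift (br : bracket) (Xi : sec_TM_Edual -> linear_section) : Prop :=
  forall nu1 nu2,
    courant_dorfman (lin_sec (Xi nu1)) (lin_sec (Xi nu2)) =
    vform_of (Xi (br nu1 nu2)).

End Dorfman_brackets.

(* Main.v *)
Require Import Defs.
From HB Require Import structures.
From mathcomp Require Import all_boot all_order all_algebra.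
From mathcomp Require Import boolp classical_sets functions.
From mathcomp Require Import ring lra.
From mathcomp Require Import reals constructive_ereal ereal topology normedtype.
From mathcomp Require Import landau derive sequences realfun exp measure.
From mathcomp Require Import lebesgue_measure lebesgue_integral ftc.

(* Write U_nu and b_nu for the vector field and the 1-form of Xi(nu).  The lift
   is determined by U_nu(q^*f) = q^*(X f), U_nu(ell_eps) = ell([[nu, (0, eps)]])
   and b_nu(W) = W(ell_nu) + ell([[nu, (Y, 0)]]) for W projecting to Y, where
   ell of a section of TM (+) E^* is ell of its second component.  These rules
   turn the Courant-Dorfman bracket of two lifts into the lift of the bracket
   plus ell of the Jacobiator at (0, eps) (evaluating the vector field on
   ell_eps) and at (Y, 0) (evaluating the form on W).  That these evaluations
   determine everything rests on tangent vectors being derivations: Hadamard's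
   lemma and bump functions show that they have coordinates, hence that a
   vector on E is determined by its values on q^*f and ell_eps, and that vector
   fields on E are locally spanned by projectable ones. *)

Set Implicit Arguments.
Unset Strict Implicit.
Unset Printing Implicit Defensive.
Import Order.TTheory GRing.Theory Num.Theory.
Import numFieldNormedType.Exports.

Local Open Scope classical_set_scope.
Local Open Scope ring_scope.

(** * Hadamard's lemma *)

Section Unit_interval_integral.
Variable R : realType.

Definition int01 (h : R -> R) : R := \int[@lebesgue_measure R]_(s in `[0, 1]) h s.

Let cont01 (h : R -> R) := forall s : R, 0 <= s <= 1 -> {for s, continuous h}.

Lemma int01_integrable h : cont01 h ->
  (@lebesgue_measure R).-integrable `[0, 1] (EFin \o h).
Proof.
move=> ch; apply: continuous_compact_integrable; first exact: segment_compact.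
by apply: continuous_in_subspaceT => s /set_mem /=; rewrite in_itv; exact: ch.
Qed.

Lemma int01D h g : cont01 h -> cont01 g ->
  int01 (fun s => h s + g s) = int01 h + int01 g.
Proof. by move=> ch cg; apply: RintegralD => //; exact: int01_integrable. Qed.

Lemma int01Z a h : cont01 h -> int01 (fun s => a * h s) = a * int01 h.
Proof. by move=> ch; apply: RintegralZl => //; exact: int01_integrable. Qed.

Lemma int01_bound h c : cont01 h -> (forall s : R, 0 <= s <= 1 -> `|h s| <= c) ->
  `|int01 h| <= c.
Proof.
move=> ch hc; have mI : measurable (`[0, 1]%classic : set (measurableTypeR R)) by [].
apply: (le_trans (le_normr_Rintegral mI (int01_integrable ch))).
have -> : c = int01 (fun=> c).
  rewrite /int01 Rintegral_cst //= lebesgue_measure_itv /= lte_fin ltr01.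
  by rewrite oppr0 addr0 /= mulr1.
apply: le_Rintegral => //.
- apply: (@int01_integrable (fun s => `|h s|)) => s s01.
  by apply: continuous_comp; [exact: ch|exact: norm_continuous].
- by apply: (@int01_integrable (fun=> c)) => s _; exact: cst_continuous.
Qed.

Lemma int01_FTC (G g : R -> R) : cont01 g ->
  (forall s : R, 0 <= s <= 1 -> is_derive s (1 : R) G (g s)) ->
  int01 g = G 1 - G 0.
Proof.
move=> cg dG; rewrite /int01 /Rintegral.
have I0 (s : R) : s \in `]0, 1[ -> 0 <= s <= 1.
  by move=> s01; rewrite !ltW // (itvP s01).
have cG s : 0 <= s <= 1 -> {for s, continuous G}.
  by move=> /dG dGs; apply: differentiable_continuous; apply/derivable1_diffP.
rewrite (continuous_FTC2 (F := G)) //=.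
- by apply: continuous_in_subspaceT => s /set_mem /=; rewrite in_itv; exact: cg.
- split=> [s /I0/dG dGs //||].
  + have := cG 0; rewrite lexx ler01 => /(_ isT).
    by apply: cvg_at_right_filter.
  + have := cG 1; rewrite lexx ler01 => /(_ isT).
    by apply: cvg_at_left_filter.
- by move=> s /I0/dG dGs; rewrite derive1E derive_val.
Qed.

End Unit_interval_integral.

(** * Differentials of functions of a row vector *)

Lemma differentiable_linear_approx (R : realType) (V : normedModType R)
    (f : V -> R) (x : V) (L : {linear V -> R}) :
  continuous L ->
  (forall eps : R, 0 < eps -> \forall w \near 0,
     `|f (w + x) - f x - L w| <= eps * `|w|) ->
  differentiable f x /\ 'd f x = L :> (V -> R).
Proof.
move=> cL H.
have E : f \o shift x = cst (f x) + L +o_ 0 id.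
  apply/eqaddoP => eps e0; apply: filterS (H _ e0) => w /=.
  by rewrite !fctE /= opprD addrA.
have dE := diff_unique cL E.
by split=> //; apply/diff_locallyP; rewrite dE.
Qed.

Lemma is_derive_line (R : realType) (V : normedModType R) (f : V -> R) (y w : V) (t : R) :
  differentiable f (t *: w + y) ->
  is_derive t (1 : R) (fun t : R => f (t *: w + y)) ('D_w f (t *: w + y)).
Proof.
move=> df; have dfw : derivable f (t *: w + y) w by exact: diff_derivable.
have E : (fun h : R => h^-1 *: (f ((h *: (1 : R) + t) *: w + y) - f (t *: w + y))) =
    (fun h => h^-1 *: (f (h *: w + (t *: w + y)) - f (t *: w + y))).
  by apply/funext => h; rewrite [h *: 1]mulr1 scalerDl addrA.
apply: DeriveDef.
  by move: dfw; rewrite /derivable /= -E.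
by rewrite /derive /= -E.
Qed.

Section Row_differential.
Variables (R : realType) (n : nat).
Implicit Types (f : 'rV[R]_n -> R) (x v w : 'rV[R]_n).

Local Notation e_ j := (delta_mx 0 j : 'rV[R]_n).

Lemma derive_row f x v : differentiable f x ->
  'D_v f x = \sum_j v 0 j * 'D_(e_ j) f x.
Proof.
move=> df; rewrite deriveE // [in LHS](row_sum_delta v) linear_sum.
by apply: eq_bigr => j _; rewrite linearZ /= deriveE.
Qed.

Lemma coord_le_norm v j : `|v 0 j| <= `|v|.
Proof. by rewrite [`|v|]mx_normrE; apply: (le_bigmax _ (fun i => `|v i.1 i.2|) (0, j)). Qed.

(** Uniqueness of the first-order expansion identifies the differential; the coefficients [a] can
    thus be guessed first and justified by an estimate. *)
Lemma differentiable_of_row f x (a : 'I_n -> R) :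
  (forall eps : R, 0 < eps -> \forall w \near (0 : 'rV[R]_n),
     `|f (w + x) - f x - \sum_j w 0 j * a j| <= eps * `|w|) ->
  differentiable f x /\ forall v, 'D_v f x = \sum_j v 0 j * a j.
Proof.
move=> H; pose L w := \sum_j w 0 j * a j : R.
have linL : linear L.
  move=> b u w; rewrite /L scaler_sumr -big_split /=; apply: eq_bigr => j _.
  by rewrite !mxE mulrDl -mulrA.
pose gL : {linear 'rV[R]_n -> R} := HB.pack L (GRing.isLinear.Build _ _ _ _ L linL).
have cL : continuous gL.
  have -> : (gL : 'rV[R]_n -> R) = \sum_j (fun w : 'rV[R]_n => w 0 j * a j).
    by apply/funext => w; rewrite fct_sumE.
  move=> w; apply: differentiable_continuous; apply: differentiable_sum => j.
  by apply: differentiableM => //; exact: differentiable_coord.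
have [df dE] : differentiable f x /\ 'd f x = gL :> ('rV[R]_n -> R).
  apply: differentiable_linear_approx cL _ => eps e0; apply: filterS (H _ e0) => w.
  by [].
by split=> // v; rewrite deriveE // dE.
Qed.

(** Strict differentiability: the mean value theorem on the segment from [y] to [w + y] turns the
    error into differences of partial derivatives, which are small because these are continuous at
    [x]. The uniformity in [y] is what later allows differentiation under the integral sign. *)
Lemma C1_strict_diff (U : set 'rV[R]_n) f x (eps : R) :
  open U -> Ck 1 U f -> U x -> 0 < eps ->
  \forall y \near x & w \near (0 : 'rV[R]_n),
    `|f (w + y) - f y - 'D_w f y| <= eps * `|w|.
Proof.
move=> oU [df Df] Ux e0.
(* The partials at [t *: w + y] and at [y] are both within [eps'] of those at [x], so each
   coordinate contributes at most [2 * eps'] times the norm of [w]. Dividing by [n.+1] instead of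
   [n] covers dimension 0. *)
pose eps' := eps / (2 * n.+1%:R).
have e'0 : 0 < eps' by rewrite divr_gt0 // mulr_gt0.
have near_good : \forall y \near x, U y /\ forall j, `|'D_(e_ j) f y - 'D_(e_ j) f x| < eps'.
  apply: filterI; first exact: open_nbhs_nbhs.
  apply: (@filter_forall _ _ (fun j y => `|'D_(e_ j) f y - 'D_(e_ j) f x| < eps') (nbhs x)) => j.
  have /cvgrPdist_lt/(_ _ e'0) := Df (e_ j) x Ux.
  by apply: filterS => y; rewrite distrC.
have /nbhs_ballP[d /= d0 Bd] := near_good.
have d20 : 0 < d / 2 by rewrite divr_gt0.
exists (ball x (d / 2), ball 0 (d / 2)).
  by split; apply/nbhs_ballP; exists (d / 2).
move=> [y w] [/= yB wB].
have good (t : R) : 0 <= t <= 1 -> U (t *: w + y) /\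
    forall j, `|'D_(e_ j) f (t *: w + y) - 'D_(e_ j) f x| < eps'.
  move=> /andP[t0 t1]; apply: Bd; move: yB wB; rewrite -!ball_normE /= sub0r normrN.
  rewrite opprD addrCA => yB wB; apply: le_lt_trans (ler_normD _ _) _.
  rewrite normrN normrZ (ger0_norm t0).
  have := ler_piMl (normr_ge0 w) t1; have := @splitr R d; lra.
pose G (t : R) := f (t *: w + y).
have dG (t : R) : 0 <= t <= 1 -> is_derive t (1 : R) G ('D_w f (t *: w + y)).
  move=> /good[Ut _]; have dft := df _ Ut.
  exact: is_derive_line.
have [t t01 Et] : exists2 t, t \in `[0, 1]%R & G 1 - G 0 = 'D_w f (t *: w + y) * (1 - 0).
  apply: MVT_segment => // [t t01|]; first by apply: dG; rewrite !ltW // (itvP t01).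
  apply: continuous_in_subspaceT => t /set_mem /=; rewrite in_itv /= => /dG dt.
  by apply: differentiable_continuous; apply/derivable1_diffP.
move: Et; rewrite subr0 mulr1 /G scale1r scale0r add0r => ->.
have t01' : 0 <= t <= 1 by rewrite !(itvP t01).
have [Ut gt] := good t t01'.
have [Uy gy] : U y /\ forall j, `|'D_(e_ j) f y - 'D_(e_ j) f x| < eps'.
  by have := good 0; rewrite scale0r add0r lexx ler01; apply.
rewrite (derive_row _ (df _ Ut)) (derive_row _ (df _ Uy)) -sumrB.
apply: le_trans (ler_norm_sum _ _ _) _.
have -> : eps * `|w| = \sum_(j < n.+1) (2 * eps' * `|w|).
  rewrite sumr_const card_ord -mulr_natr /eps'.
  have : n.+1%:R != 0 :> R by rewrite pnatr_eq0.
  by set N := _%:R => N0; field.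
rewrite big_ord_recr /= -[X in X <= _]addr0; apply: lerD; last first.
  by rewrite !mulr_ge0 // ltW.
apply: ler_sum => j _; rewrite -mulrBr normrM mulrC.
apply: ler_pM => //; last exact: coord_le_norm.
have := ler_normB ('D_(e_ j) f (t *: w + y) - 'D_(e_ j) f x) ('D_(e_ j) f y - 'D_(e_ j) f x).
have := gt j; have := gy j; rewrite opprB addrA subrK; lra.
Qed.

End Row_differential.

Lemma continuous_at_mull (R : realType) (a s : R) (h : R -> R) :
  {for s, continuous h} -> {for s, continuous (fun t => a * h t)}.
Proof.
by move=> ch; apply: (@continuousM _ _ (cst a) h) => //; exact: cst_continuous.
Qed.

Lemma continuous_at_add (R : realType) (s : R) (h g : R -> R) :
  {for s, continuous h} -> {for s, continuous g} ->
  {for s, continuous (fun t => h t + g t)}.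
Proof. by move=> ch cg; exact: (@continuousD _ _ _ h g). Qed.

(** * Radial means and the Hadamard expansion *)

Section Hadamard.
Variables (R : realType) (n : nat) (U : set 'rV[R]_n) (y0 : 'rV[R]_n).
Hypotheses (oU : open U)
  (starU : forall (s : R) y, 0 <= s <= 1 -> U y -> U (s *: (y - y0) + y0)).
Local Notation seg s y := (s *: (y - y0) + y0).
Local Notation e_ j := (delta_mx 0 j : 'rV[R]_n).

(** The weight [s ^+ j] is there because each differentiation in [y] of a value at
    [s *: (y - y0) + y0] brings out one more factor [s]. *)
Definition radial_mean j (u : 'rV[R]_n -> R) (y : 'rV[R]_n) : R :=
  int01 (fun s => s ^+ j * u (seg s y)).

Lemma radial_continuous j u y s : smooth_on U u -> U y -> 0 <= s <= 1 ->
  {for s, continuous (fun s : R => s ^+ j * u (seg s y))}.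
Proof.
move=> su Uy s01; apply: continuousM; first exact: exprn_continuous.
apply: (@continuous_comp _ _ _ (fun s : R => seg s y) u).
  apply: continuousD; [exact: scalel_continuous|exact: cst_continuous].
exact: (su 0%N _ (starU s01 Uy)).
Qed.

Lemma int01_sum m (F : 'I_m -> R -> R) :
  (forall i (s : R), 0 <= s <= 1 -> {for s, continuous (F i)}) ->
  int01 (fun s => \sum_i F i s) = \sum_i int01 (F i) /\
  forall s : R, 0 <= s <= 1 -> {for s, continuous (fun s => \sum_i F i s)}.
Proof.
elim: m F => [|m IH] F cF.
  have -> : (fun s => \sum_(i < 0) F i s) = fun=> 0.
    by apply/funext => s; rewrite big_ord0.
  split; last by move=> s _; exact: cst_continuous.
  by rewrite big_ord0 /int01 Rintegral_cst //= mul0r.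
have [E cE] := IH (fun i => F (lift ord0 i)) (fun i => cF (lift ord0 i)).
have -> : (fun s => \sum_(i < m.+1) F i s) =
    (fun s => F ord0 s + \sum_(i < m) F (lift ord0 i) s).
  by apply/funext => s; rewrite big_ord_recl.
split; first by rewrite big_ord_recl -E; apply: int01D => //; exact: cF.
by move=> s s01; apply: continuous_at_add; [exact: cF|exact: cE].
Qed.

(* The derivatives of a radial mean are again radial means, so that the class
   of all of them is closed under differentiation. *)
Lemma radial_mean_diff j u y : smooth_on U u -> U y ->
  differentiable (radial_mean j u) y /\
  forall v, 'D_v (radial_mean j u) y =
            \sum_i v 0 i * radial_mean j.+1 ('D_(e_ i) u) y.
Proof.
move=> su Uy; apply: differentiable_of_row => eps e0.
have sDu i : smooth_on U ('D_(e_ i) u) by move=> k; have [_] := su k.+1; apply.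
have C1 : Ck 1 U u by exact: su.
have segD (s : R) w : seg s (w + y) = s *: w + seg s y by rewrite -addrA scalerDr addrA.
pose P (w : 'rV[R]_n) (s : R) :=
  `|u (s *: w + seg s y) - u (seg s y) - 'D_(s *: w) u (seg s y)| <= eps * `|s *: w|.
(* Strict differentiability gives the estimate near each [(s, 0)]; compactness of the unit interval
   yields one neighbourhood of 0 for [w] that serves every [s]. *)
have nearP : \forall w \near (0 : 'rV[R]_n), `[0, 1]%classic `<=` P w.
  have /compact_near_coveringP cov := @segment_compact R 0 1.
  apply: (cov _ (nbhs (0 : 'rV[R]_n)) P) => s.
  rewrite /= in_itv /= => s01.
  have [[A B] /= [nA nB] AB] := C1_strict_diff oU C1 (starU s01 Uy) e0.
  have cseg : (fun s : R => seg s y) @ s --> seg s y.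
    by apply: cvgD; [exact: scalel_continuous|exact: cvg_cst].
  have csw : (fun z : R * 'rV[R]_n => z.1 *: z.2) @ (s, 0 : 'rV[R]_n) --> s *: (0 : 'rV[R]_n).
    by have := @scale_continuous R 'rV[R]_n (s, 0); apply.
  rewrite scaler0 in csw.
  have n1 : \forall t \near s & w \near (0 : 'rV[R]_n), A (seg t y).
    by exists ((fun t => A (seg t y)), setT) => [|[t w] [] //]; split; [exact: cseg|exact: filterT].
  have n2 : \forall t \near s & w \near (0 : 'rV[R]_n), B (t *: w).
    exact: csw.
  by apply: filterS2 n1 n2 => -[t w] /= At Bw; exact: (AB (_, _)).
have nearU : \forall w \near (0 : 'rV[R]_n), U (w + y).
  have : \forall z \near y, U z by exact: open_nbhs_nbhs.
  by rewrite (near_shift 0) subr0.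
apply: filterS2 nearP nearU => w Pw Uw.
have c1 (s : R) : 0 <= s <= 1 -> {for s, continuous (fun s : R => s ^+ j * u (seg s (w + y)))}.
  by move=> s01; exact: (@radial_continuous j _ _ s su Uw s01).
have c2 (s : R) : 0 <= s <= 1 -> {for s, continuous (fun s : R => s ^+ j * u (seg s y))}.
  by move=> s01; exact: (@radial_continuous j _ _ s su Uy s01).
have c3 i (s : R) : 0 <= s <= 1 ->
    {for s, continuous (fun s : R => - w 0 i * (s ^+ j.+1 * 'D_(e_ i) u (seg s y)))}.
  by move=> s01; apply: continuous_at_mull; exact: (@radial_continuous j.+1 _ _ s (sDu i) Uy s01).
have c2' (s : R) : 0 <= s <= 1 -> {for s, continuous (fun s : R => -1 * (s ^+ j * u (seg s y)))}.
  by move=> s01; apply: continuous_at_mull; exact: c2.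
have [E3 c3'] := int01_sum c3.
have c12 (s : R) : 0 <= s <= 1 -> {for s, continuous
   (fun s : R => s ^+ j * u (seg s (w + y)) + -1 * (s ^+ j * u (seg s y)))}.
  by move=> s01; apply: continuous_at_add; [exact: c1|exact: c2'].
(* Written as a single integral, the remainder inherits the bound on its integrand. *)
have -> : radial_mean j u (w + y) - radial_mean j u y -
    \sum_i w 0 i * radial_mean j.+1 ('D_(e_ i) u) y =
    int01 (fun s => s ^+ j * u (seg s (w + y)) + -1 * (s ^+ j * u (seg s y)) +
      \sum_i - w 0 i * (s ^+ j.+1 * 'D_(e_ i) u (seg s y))).
  rewrite int01D // int01D // int01Z // E3 mulN1r; congr (_ + _).
  rewrite -sumrN; apply: eq_bigr => i _; rewrite int01Z ?mulNr // => s s01.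
  exact: (@radial_continuous j.+1 _ _ s (sDu i) Uy s01).
apply: int01_bound => [s s01|s s01].
  by apply: continuous_at_add; [exact: c12|exact: c3'].
have Us := starU s01 Uy; have [du _] := C1.
have := Pw s; rewrite /P /= in_itv /= => /(_ s01).
rewrite (derive_row _ (du _ Us)) segD => Hs.
have -> : s ^+ j * u (s *: w + seg s y) + -1 * (s ^+ j * u (seg s y)) +
    \sum_i - w 0 i * (s ^+ j.+1 * 'D_(e_ i) u (seg s y)) =
    s ^+ j * (u (s *: w + seg s y) - u (seg s y) -
    \sum_i (s *: w) 0 i * 'D_(e_ i) u (seg s y)).
  rewrite mulrBr mulN1r mulrBr; congr (_ + _); rewrite mulr_sumr -sumrN.
  by apply: eq_bigr => i _; rewrite mxE exprSr; ring.
have /andP[s0 s1] := s01.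
rewrite normrM (ger0_norm (exprn_ge0 _ s0)); apply: le_trans (ler_piMl _ (exprn_ile1 _ s0 s1)) _ => //.
apply: le_trans Hs _; rewrite normrZ (ger0_norm s0); apply: ler_wpM2l; first exact: ltW.
exact: ler_piMl.
Qed.

(** Induction on the order of differentiability, with [j] and [u] generalised because a derivative
    raises [j] and replaces [u] by its partial derivatives. *)
Lemma radial_mean_smooth j u : smooth_on U u -> smooth_on U (radial_mean j u).
Proof.
move=> su k; elim: k j u su => [|k IH] j u su.
  move=> y Uy; apply: differentiable_continuous.
  by have [] := radial_mean_diff j su Uy.
have sDu i : smooth_on U ('D_(e_ i) u) by move=> l; have [_] := su l.+1; apply.
split=> [y Uy|v]; first by have [] := radial_mean_diff j su Uy.
have H : Ck k U (fun y => \sum_i cst (v 0 i) y * radial_mean j.+1 ('D_(e_ i) u) y).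
  apply: Ck_sum => // i; apply: CkM => //; [exact: Ck_cst|exact: IH].
by apply: Ck_ext H => // y Uy; have [_ ->] := radial_mean_diff j su Uy.
Qed.

(** The coefficient [g i] is the mean of the [i]-th partial derivative over the segment from [y0] to
    [y]; the expansion is the fundamental theorem of calculus along that segment. *)
Lemma hadamard u : smooth_on U u -> U y0 ->
  exists g : 'I_n -> 'rV[R]_n -> R,
  [/\ forall i, smooth_on U (g i),
      forall i, g i y0 = 'D_(e_ i) u y0 &
      forall y, U y -> u y = u y0 + \sum_i (y 0 i - y0 0 i) * g i y].
Proof.
move=> su Uy0; exists (fun i => radial_mean 0 ('D_(e_ i) u)).
have sDu i : smooth_on U ('D_(e_ i) u) by move=> l; have [_] := su l.+1; apply.
split=> [i|i|y Uy]; first exact: radial_mean_smooth.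
- rewrite /radial_mean subrr; under eq_fun do rewrite scaler0 add0r expr0 mul1r.
  by rewrite /int01 Rintegral_cst //= lebesgue_measure_itv /= lte_fin ltr01 oppr0 addr0 mulr1.
have c i (s : R) : 0 <= s <= 1 ->
    {for s, continuous (fun s : R => (y 0 i - y0 0 i) * (s ^+ 0 * 'D_(e_ i) u (seg s y)))}.
  by move=> s01; apply: continuous_at_mull; exact: (@radial_continuous 0 _ _ s (sDu i) Uy s01).
have [E cE] := int01_sum c.
have -> : \sum_i (y 0 i - y0 0 i) * radial_mean 0 ('D_(e_ i) u) y =
    int01 (fun s => \sum_i (y 0 i - y0 0 i) * (s ^+ 0 * 'D_(e_ i) u (seg s y))).
  rewrite E; apply: eq_bigr => i _; rewrite int01Z // => s s01.
  exact: (@radial_continuous 0 _ _ s (sDu i) Uy s01).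
have dG (s : R) : 0 <= s <= 1 -> is_derive s (1 : R) (fun s : R => u (seg s y))
    (\sum_i (y 0 i - y0 0 i) * (s ^+ 0 * 'D_(e_ i) u (seg s y))).
  move=> s01; have [du _] := su 1%N; have du' := du _ (starU s01 Uy).
  apply: is_derive_eq (is_derive_line du') _; rewrite (derive_row _ du').
  by apply: eq_bigr => i _; rewrite expr0 mul1r !mxE.
by rewrite (int01_FTC cE dG) scale1r scale0r add0r subrK addrC subrK.
Qed.

End Hadamard.

(** * Bump functions *)

Lemma smooth_onD (R : realType) n (U : set 'rV[R]_n) f g : open U ->
  smooth_on U f -> smooth_on U g -> smooth_on U (fun y => f y + g y).
Proof. by move=> oU sf sg k; exact: (CkD oU (sf k) (sg k)). Qed.

Lemma smooth_onM (R : realType) n (U : set 'rV[R]_n) f g : open U ->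
  smooth_on U f -> smooth_on U g -> smooth_on U (fun y => f y * g y).
Proof. by move=> oU sf sg k; exact: (CkM oU (sf k) (sg k)). Qed.

Lemma smooth_on_cst (R : realType) n (U : set 'rV[R]_n) (a : R) :
  smooth_on U (fun=> a).
Proof. by move=> k; exact: Ck_cst. Qed.

Section Bump.
Variable R : realType.

(** The powers of [t^-1] make this family around exp(-1/t) stable under differentiation up to linear
    combinations, so that one induction covers all orders. *)
Definition flat (m : nat) (t : R) : R :=
  if 0 < t then t^-1 ^+ m * expR (- t^-1) else 0.

Lemma flat_gt0 m t : 0 < t -> 0 < flat m t.
Proof. by move=> t0; rewrite /flat t0 mulr_gt0 ?expR_gt0 // exprn_gt0 // invr_gt0. Qed.

Lemma flat_le0 m t : t <= 0 -> flat m t = 0.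
Proof. by rewrite /flat ltNge => ->. Qed.

(** The exponential at [t^-1] dominates the term of degree [m.+2] of its series. Two degrees beyond
    [m] leave a factor [t ^+ 2], enough for a zero derivative at the origin. *)
Lemma flat_quadratic m t : `|flat m t| <= m.+2`!%:R * t ^+ 2.
Proof.
have [t0|t0] := lerP t 0.
  by rewrite flat_le0 // normr0 mulr_ge0 // sqr_ge0.
rewrite gtr0_norm ?flat_gt0 // /flat t0.
have it0 : 0 < t^-1 by rewrite invr_gt0.
have f0 : 0 < m.+2`!%:R :> R by rewrite ltr0n fact_gt0.
have := @expR_ge1Dxn R t^-1 m.+1 (ltW it0) => H.
have {}H : t^-1 ^+ m.+2 / m.+2`!%:R <= expR t^-1 by apply: le_trans H; lra.
rewrite expRN ler_pdivrMr ?expR_gt0 //.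
apply: le_trans (ler_wpM2l _ H); last first.
  by rewrite mulr_ge0 // ?sqr_ge0 // ltW.
rewrite le_eqVlt; apply/orP; left; apply/eqP.
by rewrite !exprS; field; rewrite !gt_eqF.
Qed.

(** Away from 0 this differentiates the formula valid near [t]; at 0 both terms vanish and the
    quadratic bound gives derivative 0. *)
Lemma is_derive_flat m (t : R) :
  is_derive t (1 : R) (flat m) (flat m.+2 t - m%:R * flat m.+1 t).
Proof.
have [t0|t0|->] := ltgtP t 0.
- rewrite !flat_le0 ?(ltW t0) // mulr0 subr0.
  apply: (@near_eq_is_derive R R R (cst 0)).
    near=> s; rewrite flat_le0 //.
    by apply: ltW; near: s; exact: lt_nbhsl.
- apply: (@near_eq_is_derive R R R (fun s : R => s^-1 ^+ m * expR (- s^-1))).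
    near=> s; rewrite /flat; suff -> : 0 < s by [].
    by near: s; exact: lt_nbhsr.
  have t0' : t != 0 by rewrite gt_eqF.
  have dV := is_deriveV t0' (is_derive_id t (1 : R)).
  have dX : is_derive t (1 : R) (fun s : R => s^-1 ^+ m) (m%:R * t^-1 ^+ m.-1 * (- t ^- 2)).
    have := is_deriveX m dV; rewrite exprfctE => H; apply: is_derive_eq H _.
    by rewrite !scaler1 /=.
  have dN : is_derive t (1 : R) (fun s : R => - s^-1) (t ^- 2).
    by have H := is_deriveN dV; apply: is_derive_eq H _; rewrite /= scaler1 opprK.
  have dE := @is_derive1_comp R expR (fun s : R => - s^-1) t _ _ (is_derive_expR _) dN.
  have H := is_deriveM dX dE; apply: is_derive_eq H _.
  have mE (a b : R) : a *: b = a * b by [].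
  rewrite /flat t0 /= !mE.
  rewrite -!exprVn; case: m {dX} => [|m] /=.
    by rewrite !mul0r mulr0 expr0 addr0 subr0 mul1r mulrC.
  by rewrite !exprS; ring.
- rewrite !flat_le0 // mulr0 subr0.
  have cst0 : continuous (@GRing.null_fun R R : {linear R -> R}) by exact: cst_continuous.
  have [d dE] : differentiable (flat m) (0 : R) /\ 'd (flat m) (0 : R) = \0 :> (R -> R).
    apply: (differentiable_linear_approx cst0) => eps e0.
    have f0 : 0 < m.+2`!%:R :> R by rewrite ltr0n fact_gt0.
    near=> w; rewrite addr0 (@flat_le0 m 0) // subr0 /= subr0.
    apply: le_trans (flat_quadratic m w) _.
    rewrite -real_normK ?num_real // expr2 mulrA; apply: ler_wpM2r => //.
    rewrite -ler_pdivlMl // mulrC; near: w.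
    apply/nbhs_ballP; exists (eps / m.+2`!%:R); first by rewrite /= divr_gt0.
    by move=> x; rewrite -ball_normE /= sub0r normrN; exact: ltW.
  apply: DeriveDef; first exact/derivable1_diffP.
  by rewrite deriveE // dE.
Unshelve. all: by end_near. Qed.

(** [smooth_on] speaks of row vectors, so the real line enters as ['rV[R]_1]. *)
Lemma flat_row_smooth m : smooth_on setT (fun z : 'rV[R]_1 => flat m (z 0 0)).
Proof.
move=> k; elim: k m => [|k IH] m.
  move=> z _; apply: (@continuous_comp _ _ _ (fun z : 'rV[R]_1 => z 0 0) (flat m)).
    exact: coord_continuous.
  apply: differentiable_continuous; apply/derivable1_diffP.
  by have [] := is_derive_flat m (z 0 0).
have df (z : 'rV[R]_1) : differentiable (flat m) (z 0 0).
  by apply/derivable1_diffP; have [] := is_derive_flat m (z 0 0).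
have dc (z : 'rV[R]_1) : differentiable (fun z : 'rV[R]_1 => z 0 0 : R) z.
  exact: differentiable_coord.
split=> [z _|v].
  by apply: (@differentiable_comp _ _ _ _ (fun z : 'rV[R]_1 => z 0 0) (flat m)).
have H : Ck k setT (fun z : 'rV[R]_1 => cst (v 0 0) z *
    (flat m.+2 (z 0 0) + cst (- m%:R) z * flat m.+1 (z 0 0))).
  apply: CkM; [exact: openT|exact: Ck_cst|].
  apply: CkD; [exact: openT|exact: IH|].
  by apply: CkM; [exact: openT|exact: Ck_cst|exact: IH].
apply: Ck_ext H => // [|z _]; first exact: openT.
have -> : (fun z : 'rV[R]_1 => flat m (z 0 0)) = flat m \o (fun z => z 0 0) by [].
rewrite deriveE; last exact: differentiable_comp.
rewrite diff_comp //=.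
have -> : 'd (fun z : 'rV[R]_1 => z 0 0 : R) z v = v 0 0.
  have lin : linear (fun y : 'rV[R]_1 => y 0 0 : R) by move=> a u w; rewrite !mxE.
  pose gL : {linear 'rV[R]_1 -> R} :=
    HB.pack (fun y : 'rV[R]_1 => y 0 0 : R) (GRing.isLinear.Build _ _ _ _ _ lin).
  by rewrite (@diff_lin _ _ _ gL) //; exact: coord_continuous.
have [_ E] := is_derive_flat m (z 0 0).
by rewrite diff1E // derive1E E /= mulNr.
Qed.

Lemma smooth_flat n (U : set 'rV[R]_n) q m :
  open U -> smooth_on U q -> smooth_on U (fun y => flat m (q y)).
Proof.
move=> oU sq.
have := @smooth_on_comp R n 1 U setT _ (fun y => const_mx (q y)) oU _ _ (flat_row_smooth m).
have -> : (fun x : 'rV[R]_n => flat m ((const_mx (q x) : 'rV[R]_1) 0 0)) = (fun y => flat m (q y)).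
  by apply/funext => y; rewrite mxE.
by apply=> // j k; apply: Ck_ext (sq k) => // y _; rewrite mxE.
Qed.

(** Two nested cutoffs: [chi] turns chart coordinates into global functions, and [rho] localises
    identities to a place where [chi] is 1 and these functions are the true coordinates. *)
Lemma cutoff_row n (W : set 'rV[R]_n) y0 : open W -> W y0 ->
  exists (chi rho : 'rV[R]_n -> R) (K : set 'rV[R]_n),
  [/\ smooth_on setT chi, smooth_on setT rho, compact K, K `<=` W &
   [/\ forall y, ~ K y -> chi y = 0 /\ rho y = 0, rho y0 = 1 &
       forall y, rho y != 0 -> chi y = 1]].
Proof.
move=> oW Wy0.
have oT : open [set: 'rV[R]_n] by exact: openT.
have /nbhs_ballP[d /= d0 Bd] : nbhs y0 W by exact: open_nbhs_nbhs.
pose r := d / 2; have r0 : 0 < r by rewrite divr_gt0.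
have r2 : 0 < r ^+ 2 by rewrite exprn_gt0.
(* [q] is positive only inside the Euclidean ball of radius [r], which lies in the closed ball of
   the maximum norm, so the bump built from it vanishes off that closed ball. Halving [d] keeps the
   closed ball inside [W]. *)
pose q (y : 'rV[R]_n) := r ^+ 2 +
  \sum_i -1 * ((y 0 i + - y0 0 i) * (y 0 i + - y0 0 i)).
have sq : smooth_on setT q.
  have s1 i : smooth_on setT (fun y : 'rV[R]_n => y 0 i + - y0 0 i).
    by apply: (smooth_onD oT _ (smooth_on_cst _ _)) => k; exact: Ck_coord.
  apply: (smooth_onD oT (smooth_on_cst _ _)) => k; apply: Ck_sum => // i.
  exact: (smooth_onM oT (smooth_on_cst _ _) (smooth_onM oT (s1 i) (s1 i))).
have qle y i : q y <= r ^+ 2 - (y 0 i - y0 0 i) ^+ 2.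
  rewrite /q /= lerD2l (bigD1 i) //= mulN1r -expr2 -[X in _ <= X]addr0 lerD2l.
  by apply: sumr_le0 => j _; rewrite mulN1r -expr2 oppr_le0 sqr_ge0.
have qy0 : q y0 = r ^+ 2.
  rewrite /q /= big1 ?addr0 // => i _; by rewrite subrr mul0r mulr0.
have fr : 0 < flat 0 (r ^+ 2) by exact: flat_gt0.
have f1 : 0 < flat 0 (1 : R) by exact: flat_gt0.
pose b y := (flat 0 (r ^+ 2))^-1 * flat 0 (q y).
have sb : smooth_on setT b.
  exact: (smooth_onM oT (smooth_on_cst _ _) (smooth_flat 0 oT sq)).
pose c (a1 a2 : R) y := (flat 0 (1 : R))^-1 * flat 0 (a1 + a2 * b y).
have sc a1 a2 : smooth_on setT (c a1 a2).
  apply: (smooth_onM oT (smooth_on_cst _ _)); apply: (smooth_flat 0 oT).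
  exact: (smooth_onD oT (smooth_on_cst _ _) (smooth_onM oT (smooth_on_cst _ _) sb)).
(* b peaks at b(y0) = 1; rho = flat(2b - 1) / flat 1 lives where b > 1/2, and
   there chi = 1 - flat(1 - 2b) / flat 1 is 1. *)
exists (fun y => 1 + -1 * c 1 (-2) y), (c (-1) 2), (closed_ball y0 r).
split.
- apply: (smooth_onD oT (smooth_on_cst _ _)).
  exact: (smooth_onM oT (smooth_on_cst _ _)).
- exact: sc.
- apply: bounded_closed_compact; last exact: closed_ball_closed.
  exists (r + `|y0|); split; first exact: num_real.
  move=> M rM y; rewrite closed_ballE // /closed_ball_ /= => yr; apply: le_trans (ltW rM).
  by rewrite -[y](subKr y0); apply: le_trans (ler_normB _ _) _; rewrite addrC lerD2r.
- move=> y; rewrite closed_ballE // /closed_ball_ /= => yr; apply: Bd.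
  rewrite -ball_normE /ball_ /=; apply: le_lt_trans yr _.
  by rewrite /r ltr_pdivrMr // ltr_pMr // ltr1n.
split.
- move=> y Ky; have b0 : b y = 0.
    have [qy|qy] := lerP (q y) 0; first by rewrite /b (@flat_le0 _ (q y)) ?mulr0.
    case: Ky.
    rewrite closed_ballE // /closed_ball_ /= [`|_|]mx_normrE; apply: bigmax_le; first exact: ltW.
    move=> [i j] _ /=; rewrite (ord1 i) !mxE distrC -ler_sqr ?nnegrE //; last exact: ltW.
    rewrite real_normK ?num_real // -subr_ge0.
    by apply: ltW; exact: lt_le_trans qy (qle y j).
  split; first by rewrite /c /= b0 mulr0 addr0 mulVf ?gt_eqF // mulN1r subrr.
  by rewrite /c b0 mulr0 addr0 (@flat_le0 _ (-1)) ?mulr0 // lerN10.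
- have b1 : b y0 = 1 by rewrite /b qy0 mulVf ?gt_eqF.
  have E1 : -1 + 2 * 1 = 1 :> R by ring.
  by rewrite /c b1 E1 mulVf ?gt_eqF.
- move=> y; rewrite /c /=; have [h|h] := lerP (-1 + 2 * b y) 0.
    by rewrite (@flat_le0 _ (-1 + _)) // mulr0 eqxx.
  by move=> _; rewrite (@flat_le0 _ (1 + _)) ?mulr0 ?addr0 //; lra.
Qed.

End Bump.

(** * Extension by zero from a chart to the manifold *)

Section Manifold.
Variables (R : realType) (n : nat) (N : manifold R n).
Implicit Types (c d : chart R n N).

Lemma chart_open_capI (U V : set N) : chart_open (charts N) U ->
  chart_open (charts N) V -> chart_open (charts N) (U `&` V).
Proof.
move=> oU oV c Nc.
have -> : c @` ((U `&` V) `&` c_dom c) = c @` (U `&` c_dom c) `&` c @` (V `&` c_dom c).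
  apply/seteqP; split=> [_ [x [[Ux Vx] cx] <-]|_ [[x [Ux cx] <-] [z [Vz cz] E]]].
    by split; exists x.
  exists x => //; split=> //; split=> //.
  by rewrite -(c_mapK cx) -E c_mapK.
by apply: openI; [exact: oU|exact: oV].
Qed.

Lemma chart_openT : chart_open (charts N) setT.
Proof. by move=> c Nc; rewrite setTI; exact: c_open. Qed.

Lemma chart_open_neq0 (f : Cinf N) : chart_open (charts N) [set x | f x != 0].
Proof.
move=> c Nc.
have -> : c @` ([set x | f x != 0] `&` c_dom c) =
    c_cod c `&` [set y | f (c_inv c y) != 0].
  apply/seteqP; split=> [_ [x [fx cx] <-]|_ [[x cx <-]]].
    by split; [exact: c_cod_map|rewrite /= c_mapK].
  by rewrite /= c_mapK // => fx; exists x.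
rewrite openE => y [cy fy].
have nf : \forall z \near y, f (c_inv c z) != 0.
  have cf : {for y, continuous (fun y => f (c_inv c y))} := @cinfP _ _ _ f c Nc 0%N y cy.
  by apply: (cf [set a | a != 0]); apply: open_nbhs_nbhs; split=> //; exact: open_neq.
have nc : \forall z \near y, c_cod c z by apply: open_nbhs_nbhs; split=> //; exact: c_open.
by apply: filterS2 nf nc.
Qed.

(** A compact set inside a chart is closed in the whole manifold: the Hausdorff property separates
    [z] from each of its points, and compactness leaves one neighbourhood of [z]. *)
Lemma compact_chart_closed c (K : set 'rV[R]_n) z : charts N c -> compact K ->
  K `<=` c_cod c -> ~ (c_dom c z /\ K (c z)) ->
  exists V, [/\ chart_open (charts N) V, V z & forall x, V x -> c_dom c x -> ~ K (c x)].
Proof.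
move=> Nc cK Kc zK.
(* Open sets of the manifold are given by [chart_open], so the neighbourhood filter of [z] is
   generated by hand. *)
pose F : set_system N := filter_from [set U | chart_open (charts N) U /\ U z] id.
have FF : Filter F.
  apply: filter_from_filter; first by exists setT; split=> //; exact: chart_openT.
  move=> U V [oU Uz] [oV Vz]; exists (U `&` V) => //; split=> //.
  exact: chart_open_capI.
have [V [oV Vz] VK] : F (fun x => K `<=` fun y => x <> c_inv c y).
  have /compact_near_coveringP cov := cK.
  apply: (cov _ F (fun x y => x <> c_inv c y)) => y Ky.
  have [cy Ey] := c_codP (Kc _ Ky).
  have zy : z <> c_inv c y by move=> zy; apply: zK; rewrite zy Ey.
  have [A [B [oA oB Az By AB]]] := atlas_hausdorff (mfd_str N) zy.
  exists (c @` (B `&` c_dom c), A); first split.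
  - apply: open_nbhs_nbhs; split; first exact: oB.
    by exists (c_inv c y).
  - by exists A.
  move=> [_ x] [/= [b [Bb cb] <-] Ax]; rewrite c_mapK // => xb.
  have : (A `&` B) x by split=> //; rewrite xb.
  by rewrite AB.
exists V; split=> // x Vx cx Kx; apply: (VK x Vx _ Kx).
by rewrite c_mapK.
Qed.

Definition zext c (g : 'rV[R]_n -> R) (x : N) : R :=
  if `[< c_dom c x >] then g (c x) else 0.

Lemma zextE c g x : c_dom c x -> zext c g x = g (c x).
Proof. by move=> cx; rewrite /zext asboolT. Qed.

Lemma zext0 c g x : (c_dom c x -> g (c x) = 0) -> zext c g x = 0.
Proof. by move=> H; rewrite /zext; case: asboolP. Qed.

(** Near a point of the compact set the extension is [g] read in the chart; near any other point it
    is zero, the compact set being closed in the manifold. *)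
Lemma zext_smooth c (K W : set 'rV[R]_n) g : charts N c -> compact K ->
  K `<=` W -> W `<=` c_cod c -> smooth_on W g -> (forall y, ~ K y -> g y = 0) ->
  is_smooth (zext c g).
Proof.
move=> Nc cK KW Wc sg g0 c0 Nc0; apply: smooth_on_local => y /c_codP[c0x Ey].
set x := c_inv c0 y in c0x Ey.
have [[cx Kx]|nK] := pselect (c_dom c x /\ K (c x)).
  have sg' : smooth_on (c_cod c) g.
    apply: smooth_on_local => u _; have [Ku|nKu] := pselect (K u).
      by exists W; split=> //; exact: KW.
    exists (~` K); split=> //; apply: (@smooth_on_ext _ _ _ (cst 0)).
    - by apply: closed_openC; apply: compact_closed => //; exact: norm_hausdorff.
    - by move=> v /g0.
    - by move=> k; exact: Ck_cst.
  exists (c0 @` (c_dom c0 `&` c_dom c)); split; first by exists x.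
  apply: smooth_on_ext (smooth_on_chart Nc0 Nc sg').
    by have [] := atlas_compat Nc0 Nc.
  by move=> _ [v [c0v cv] <-]; rewrite c_mapK // zextE.
have [V [oV Vx VK]] := compact_chart_closed Nc cK (subset_trans KW Wc) nK.
exists (c0 @` (V `&` c_dom c0)); split; first by exists x.
apply: (@smooth_on_ext _ _ _ (cst 0)); first exact: oV.
  by move=> _ [v [Vv c0v] <-]; rewrite c_mapK // zext0 // => cv; apply: g0; exact: VK.
by move=> k; exact: Ck_cst.
Qed.

End Manifold.

(** * Tangent vectors in coordinates *)

Section Tangent_coordinates.
Variables (R : realType) (n : nat) (N : manifold R n).
Local Notation e_ j := (delta_mx 0 j : 'rV[R]_n).

Lemma tan_cst (p : N) (v : tangent p) (a : R) : v (cinf_cst N a) = 0.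
Proof.
have v1 : v 1 = 0.
  have := tan_leibniz v 1 1; rewrite !mulr1 !cinf1E mul1r => H.
  by apply: (addrI (v 1)); rewrite addr0 -H.
by have := tan_linear v a 1 0; rewrite mulr1 addr0 tan_map0 addr0 v1 mulr0.
Qed.

Lemma tan_sum (p : N) (v : tangent p) m (F : 'I_m -> Cinf N) :
  v (\sum_i F i) = \sum_i v (F i).
Proof.
elim: m F => [|m IH] F; first by rewrite !big_ord0 tan_map0.
by rewrite !big_ord_recl tan_mapD IH.
Qed.

Lemma cinf_sumE m (F : 'I_m -> Cinf N) x : (\sum_i F i) x = \sum_i F i x.
Proof.
elim: m F => [|m IH] F; first by rewrite !big_ord0.
by rewrite !big_ord_recl cinfDE IH.
Qed.

(** A derivation at [p] kills constants, and on a product with a factor vanishing at [p] it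
    differentiates that factor alone. Applied to Hadamard's expansion, made global by a bump
    function, this gives the formula. The [F i] are coordinates on the neighbourhood [O] only, so
    that cut-off coordinates qualify. *)
Lemma tangent_coord (c : chart R n N) (O : set N) (p : N) (v : tangent p)
    (f : Cinf N) (F : 'I_n -> Cinf N) :
  charts N c -> c_dom c p -> chart_open (charts N) O -> O p ->
  (forall i x, O x -> c_dom c x -> F i x = c x 0 i) ->
  v f = \sum_i 'D_(e_ i) (fun y => f (c_inv c y)) (c p) * v (F i).
Proof.
move=> Nc cp oO Op FE.
have oOc : open (c @` (O `&` c_dom c)) by exact: oO.
have /nbhs_ballP[d /= d0 Bd] : nbhs (c p) (c @` (O `&` c_dom c)).
  by apply: open_nbhs_nbhs; split=> //; exists p.
pose B := ball (c p) d.
have oB : open B by exact: ball_open.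
have Bp : B (c p) by exact: ballxx.
have Bc : B `<=` c_cod c by move=> y /Bd[x [_ cx] <-]; exact: c_cod_map.
have starB (s : R) y : 0 <= s <= 1 -> B y -> B (s *: (y - c p) + c p).
  move=> /andP[s0 s1]; rewrite /B -ball_normE /ball_ /= => yB.
  rewrite opprD addrCA subrr addr0 normrN normrZ (ger0_norm s0).
  by rewrite -(normrN (y - _)) opprB; apply: le_lt_trans yB; exact: ler_piMl.
have sf : smooth_on B (fun y => f (c_inv c y)).
  by move=> k; apply: Ck_sub (cinfP f Nc k).
have [g [sg g0 gE]] := hadamard oB starB sf Bp.
have [chi [rho [K [_ srho cK KB [K0 rho1 _]]]]] := cutoff_row oB Bp.
have sG i : is_smooth (zext c (fun y => rho y * g i y)).
  apply: (zext_smooth Nc cK KB Bc).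
    apply: (smooth_onM oB _ (sg i)) => k; exact: Ck_sub (srho k).
  by move=> y /K0[_ ->]; rewrite mul0r.
have sRho : is_smooth (zext c rho).
  apply: (zext_smooth Nc cK KB Bc) => [k|y /K0[]//]; exact: Ck_sub (srho k).
pose rhoN := MkCinf sRho; pose G i := MkCinf (sG i).
(* Hadamard's expansion multiplied by [rho], as an identity of global functions: both sides vanish
   off the part of the chart lying over [K]. *)
have E : rhoN * (f + - cinf_cst N (f p)) =
    \sum_i (F i + - cinf_cst N (c p 0 i)) * G i.
  apply: cinf_ext => x; rewrite cinf_sumE cinfME cinfDE cinfNE /=.
  have [[cx Kx]|nK] := pselect (c_dom c x /\ K (c x)); last first.
    have rho0 : c_dom c x -> rho (c x) = 0.
      by move=> cx; have [] := K0 (c x) => // Kx; apply: nK.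
    rewrite zext0 // mul0r big1 // => i _; rewrite zext0 ?mulr0 // => /rho0 ->.
    by rewrite mul0r.
  have Bx := KB _ Kx; have [z [Oz cz] zx] := Bd _ Bx.
  have Exz : z = x by rewrite -(c_mapK cz) zx c_mapK.
  rewrite Exz in Oz.
  have := gE _ Bx; rewrite !c_mapK // => ->.
  rewrite zextE // addrAC subrr add0r mulr_sumr.
  by apply: eq_bigr => i _; rewrite zextE // FE // mulN1r mulrCA.
have /(congr1 v) := E.
rewrite tan_leibniz tan_sum cinfDE cinfNE /= subrr mul0r addr0 zextE // rho1 mul1r.
rewrite tan_mapD tan_mapN tan_cst subr0 => ->; apply: eq_bigr => i _.
rewrite tan_leibniz cinfDE cinfNE /= FE // subrr mul0r add0r zextE // rho1 mul1r g0.
by rewrite tan_mapD tan_mapN tan_cst subr0.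
Qed.

Section Coordinate_field.
Variables (c : chart R n N) (Nc : charts N c) (chi : 'rV[R]_n -> R)
  (K W : set 'rV[R]_n).
Hypotheses (cK : compact K) (KW : K `<=` W) (Wc : W `<=` c_cod c) (oW : open W)
  (schi : smooth_on W chi) (chi0 : forall y, ~ K y -> chi y = 0).

(** The coordinate derivation of the chart, cut off by [chi] so that extension by zero makes it a
    global vector field. *)
Definition coord_fun (i : 'I_n) (f : Cinf N) : N -> R :=
  zext c (fun y => chi y * 'D_(e_ i) (fun y => f (c_inv c y)) y).

Let df (f : Cinf N) x : c_dom c x -> differentiable (fun y => f (c_inv c y)) (c x).
Proof. by move=> cx; have [+ _] := @cinfP _ _ N f c Nc 1%N; apply; exact: c_cod_map. Qed.

Lemma coord_linear i q a (f g : Cinf N) :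
  coord_fun i (cinf_cst N a * f + g) q = a * coord_fun i f q + coord_fun i g q.
Proof.
have [cq|nq] := pselect (c_dom c q); last by rewrite /coord_fun !zext0 // mulr0 addr0.
rewrite /coord_fun !zextE // mulrCA -mulrDr; congr (_ * _).
have -> : (fun y => (cinf_cst N a * f + g) (c_inv c y)) =
    (a \*: (fun y => f (c_inv c y))) + (fun y => g (c_inv c y)) by [].
rewrite deriveD; [|exact/derivableZ/diff_derivable/df|exact/diff_derivable/df].
by rewrite deriveZ //; exact/diff_derivable/df.
Qed.

Lemma coord_leibniz i q (f g : Cinf N) :
  coord_fun i (f * g) q = f q * coord_fun i g q + g q * coord_fun i f q.
Proof.
have [cq|nq] := pselect (c_dom c q); last by rewrite /coord_fun !zext0 // !mulr0 addr0.
rewrite /coord_fun !zextE // mulrCA [g q * _]mulrCA -mulrDr; congr (_ * _).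
have -> : (fun y => (f * g) (c_inv c y)) =
    (fun y => f (c_inv c y)) * (fun y => g (c_inv c y)) by [].
by rewrite deriveM; [rewrite c_mapK|exact/diff_derivable/df|exact/diff_derivable/df].
Qed.

Lemma coord_smooth i : smooth_vfield (fun q => MkTangent (coord_linear i q) (coord_leibniz i q)).
Proof.
move=> f; apply: (zext_smooth Nc cK KW Wc); last by move=> y /chi0 ->; rewrite mul0r.
apply: (smooth_onM oW schi) => k; apply: Ck_sub Wc _.
by have [_] := @cinfP _ _ N f c Nc k.+1; apply.
Qed.

Definition coord_field i : Gamma (tangent_bundle N) :=
  @MkGamma _ _ _ (tangent_bundle N) _ (coord_smooth i).

End Coordinate_field.

(** Where [rho] is nonzero the cutoff [chi] is 1, and this is the coordinate expansion of [v];
    elsewhere both sides vanish. It supplies a local frame made of global fields. *)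
Lemma partial_dual_basis (p : N) : exists (rho : Cinf N) (x : 'I_n -> Cinf N)
    (Y : 'I_n -> Gamma (tangent_bundle N)),
  rho p = 1 /\ forall q (v : tangent q) f,
    rho q * v f = rho q * \sum_i v (x i) * Y i q f.
Proof.
have [c Nc cp] := atlas_cover (mfd_str N) p.
have oW := c_open c; rewrite -/(c_cod c) in oW.
have [chi [rho [K [schi srho cK KW [K0 rho1 rho_chi]]]]] := cutoff_row oW (c_cod_map cp).
have WW : c_cod c `<=` c_cod c by [].
have schiW : smooth_on (c_cod c) chi by move=> k; exact: Ck_sub (schi k).
have sx i : is_smooth (zext c (fun y => chi y * y 0 i)).
  apply: (zext_smooth Nc cK KW WW); last by move=> y /K0[-> _]; rewrite mul0r.
  by apply: (smooth_onM oW schiW) => k; exact: Ck_coord.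
have sRho : is_smooth (zext c rho).
  apply: (zext_smooth Nc cK KW WW) => [k|y /K0[]//]; exact: Ck_sub (srho k).
pose rhoN := MkCinf sRho; pose x i := MkCinf (sx i).
have chi0 y : ~ K y -> chi y = 0 by case/K0.
exists rhoN, x, (coord_field Nc cK KW WW oW schiW chi0).
split; first by rewrite /= zextE.
move=> q v f; have [->|nz] := eqVneq (rhoN q) 0; first by rewrite !mul0r.
congr (_ * _).
have cq : c_dom c q by apply: contrapT => ncq; move: nz; rewrite /= zext0 ?eqxx.
rewrite (tangent_coord v f Nc cq (@chart_open_neq0 _ _ _ rhoN) nz (F := x)).
  apply: eq_bigr => i _; rewrite mulrC; congr (_ * _).
  rewrite /= /coord_fun zextE // rho_chi ?mul1r //.
  by move: nz; rewrite /= zextE.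
move=> i z; rewrite /= => nz' cz; move: nz'; rewrite !zextE // => /rho_chi ->.
by rewrite mul1r.
Qed.

End Tangent_coordinates.

(** * Sections of a vector bundle *)

(** Smooth maps are continuous for the topology given by the charts, because their coordinate
    expressions are. *)
Lemma smooth_map_preimage (R : realType) n m (N : manifold R n) (P : manifold R m)
    (F : N -> P) (U : set P) :
  smooth_map F -> chart_open (charts P) U -> chart_open (charts N) (F @^-1` U).
Proof.
move=> sF oU c0 Nc0; rewrite openE => _ [x [Ux c0x] <-].
have [c [d [Nc Pd cx cd sd]]] := sF x.
have [oD _] := atlas_compat Nc0 Nc.
have Dx : (c0 @` (c_dom c0 `&` c_dom c)) (c0 x) by exists x.
have ct : {for c0 x, continuous (fun y => d (F (c_inv c (c (c_inv c0 y)))))}.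
  by apply: continuous_row => j; apply: (smooth_on_chart Nc0 Nc (sd j) 0%N).
have nU : \forall y \near c0 x, (d @` (U `&` c_dom d)) (d (F (c_inv c (c (c_inv c0 y))))).
  apply: ct; rewrite !c_mapK //; apply: open_nbhs_nbhs; split; first exact: oU.
  by exists (F x) => //; split=> //; exact: cd.
have nD : \forall y \near c0 x, (c0 @` (c_dom c0 `&` c_dom c)) y by exact: open_nbhs_nbhs.
apply: filterS2 nU nD => y Uy [z [c0z cz] Ey]; exists z => //; split=> //.
move: Uy; rewrite -Ey c_mapK // c_mapK // => -[w [Uw dw] E].
by rewrite /preimage /= -(c_mapK (cd _ cz)) -E c_mapK.
Qed.

Section Bundle_sections.
Variables (R : realType) (n k : nat) (M : manifold R n) (E : vbundle M k).

(** A section constant in a trivialisation is multiplied by a bump function. As the lift is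
    described along sections, this makes its formula available at every point of the total space. *)
Lemma section_through (p : tot E) :
  exists e : Gamma (bundle_sections E), sec_map e (qE p) = p.
Proof.
case: p => x a; have [c [h [d [Mc cx Ed B]]]] := vb_triv E x.
have [hlin dc dE] := B.
have oW := c_open c; rewrite -/(c_cod c) in oW.
have [chi [rho [K [_ srho cK KW [K0' rho1 _]]]]] := cutoff_row oW (c_cod_map cx).
have K0 y : ~ K y -> rho y = 0 by move=> /K0'[].
(* Off the domain of [c] the value is arbitrary: the factor [zext c rho] vanishes there. *)
have exb m : exists b : E m, c_dom c m -> h m b = h x a.
  have [cm|ncm] := pselect (c_dom c m); last by exists 0.
  by have [_ [g _ hg]] := hlin m cm; exists (g (h x a)).
pose b m := projT1 (cid (exb m)).
have bE m : c_dom c m -> h m (b m) = h x a by rewrite /b; case: cid.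
pose s m : E m := zext c rho m *: b m.
have hZ (c1 : chart R n M) (h1 : forall x, E x -> 'rV[R]_k) m (t : R) (u : E m) :
    (forall x, c_dom c1 x -> linear (h1 x) /\ bijective (h1 x)) -> c_dom c1 m ->
    h1 m (t *: u) = t *: h1 m u.
  move=> h1lin c1m; have [lin _] := h1lin m c1m.
  have h0 : h1 m 0 = 0.
    by apply: (addrI (h1 m 0)); rewrite -{1}[h1 m 0]scale1r -lin scaler0 !addr0.
  by rewrite -[t *: u]addr0 lin h0 addr0.
have ss : smooth_vbsection s.
  apply: vbsection_of_local => c' h' d' Mc' Ed' B' j.
  have [hlin' dc' dE'] := B'.
  apply: smooth_on_local => y /c_codP[c'm Ey]; set m := c_inv c' y in c'm Ey.
  have [[cm Km]|nK] := pselect (c_dom c m /\ K (c m)); last first.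
    have [V [oV Vm VK]] := compact_chart_closed Mc cK KW nK.
    exists (c' @` (V `&` c_dom c')); split; first by exists m.
    apply: (@smooth_on_ext _ _ _ (cst 0)); first exact: oV.
      move=> _ [z [Vz c'z] <-]; rewrite c_mapK // /s zext0.
        by rewrite (hZ c') // scale0r mxE.
      by move=> cz; apply: K0; exact: VK.
    by move=> l; exact: Ck_cst.
  have [oT sT] := atlas_compat Ed Ed'.
  have [oD sD] := atlas_compat Mc' Mc.
  (* [F] is the section read in the bundle chart [d]; the transition from [d] to [d'] carries its
     smoothness to the trivialisation [h']. *)
  pose F y := row_mx (c (c_inv c' y)) (rho (c (c_inv c' y)) *: h x a).
  have ds z : c_dom c z -> d (pt (s z)) = row_mx (c z) (rho (c z) *: h x a).
    by move=> cz; rewrite dE /=; [rewrite /s (hZ c) // zextE // bE|exact/dc].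
  exists (c' @` (c_dom c' `&` c_dom c)); split; first by exists m.
  have sF i : smooth_on (c' @` (c_dom c' `&` c_dom c)) (fun y => F y 0 i).
    case: (fintype.splitP i) => l il.
      have -> : i = lshift k l by exact: val_inj.
      apply: smooth_on_ext (sD l) => // z _; by rewrite /F row_mxEl.
    have -> : i = rshift n l by exact: val_inj.
    have srW : smooth_on (c_cod c) rho by move=> q; exact: Ck_sub (srho q).
    apply: smooth_on_ext (smooth_onM oD (smooth_on_chart Mc' Mc srW) (smooth_on_cst _ (h x a 0 l))) => //.
    by move=> z _; rewrite /F row_mxEr mxE.
  apply: smooth_on_ext (smooth_on_comp oD _ sF (sT (rshift n j))) => //.
    move=> _ [z [c'z cz] <-]; rewrite /F c_mapK // -ds // c_mapK; last exact/dc.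
    by rewrite dE' ?row_mxEr //; exact/dc'.
  move=> _ [z [c'z cz] <-]; exists (pt (s z)); first by split; [exact/dc|exact/dc'].
  by rewrite /F c_mapK // ds.
exists (@MkGamma _ _ _ (bundle_sections E) s ss).
rewrite /sec_map /= /s zextE // rho1 scale1r; congr existT.
have [_ hb] := hlin x cx; exact: (bij_inj hb (bE x cx)).
Qed.

Section Coordinate_covector.
Variables (c : chart R n M) (h : forall x, E x -> 'rV[R]_k)
  (d : chart R (n + k) (tot E)) (chi : 'rV[R]_n -> R) (K : set 'rV[R]_n).
Hypotheses (Mc : charts M c) (Ed : charts (tot E) d) (B : bundle_chart (fib := E) c h d)
  (schi : smooth_on setT chi) (cK : compact K) (KW : K `<=` c_cod c)
  (chi0 : forall y, ~ K y -> chi y = 0).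

(** The cutoff depends on the base point alone, so the coordinate stays linear on fibres and becomes
    a global section of the dual bundle. *)
Definition fiber_coord (j : 'I_k) (m : M) (u : E m) : R :=
  if `[< c_dom c m >] then chi (c m) * h u 0 j else 0.

Lemma fiber_coord_linear j m a (u v : E m) :
  fiber_coord j (a *: u + v) = a * fiber_coord j u + fiber_coord j v.
Proof.
rewrite /fiber_coord; case: asboolP => [cm|_]; last by rewrite mulr0 addr0.
by have [hlin _ _] := B; have [lin _] := hlin m cm; rewrite lin !mxE mulrDr mulrCA.
Qed.

Lemma fiber_coord_smooth j : smooth_dualsection (fun m => MkDual (@fiber_coord_linear j m)).
Proof.
have [hlin dc dE] := B.
move=> d0 Ed0; apply: smooth_on_local => y /c_codP[d0p Ey]; set p := c_inv d0 y in d0p Ey.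
have [[cm Km]|nK] := pselect (c_dom c (qE p) /\ K (c (qE p))); last first.
  have [V [oV Vm VK]] := compact_chart_closed Mc cK KW nK.
  have oqV := smooth_map_preimage (@qE_smooth _ _ _ _ E) oV.
  exists (d0 @` ((@qE _ _ _ _ E) @^-1` V `&` c_dom d0)); split; first by exists p.
  apply: (@smooth_on_ext _ _ _ (cst 0)); first exact: oqV.
    move=> _ [z [Vz d0z] <-]; rewrite c_mapK //= /fiber_coord.
    by case: asboolP => // cz; rewrite chi0 ?mul0r //; exact: VK.
  by move=> l; exact: Ck_cst.
have [oT sT] := atlas_compat Ed0 Ed.
exists (d0 @` (c_dom d0 `&` c_dom d)); split; first by exists p => //; split=> //; exact/dc.
have sL : smooth_on (c_cod d) (fun z : 'rV[R]_(n + k) => chi (lsubmx z) * z 0 (rshift n j)).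
  apply: (smooth_onM (c_open d)); last by move=> l; exact: Ck_coord.
  apply: (smooth_on_comp (c_open d) (W := setT) (F := fun z : 'rV[R]_(n + k) => lsubmx z)) => // i l.
  apply: (@Ck_ext _ _ _ _ (fun z => z 0 (lshift k i))); first exact: c_open.
    by move=> z _; rewrite mxE.
  exact: Ck_coord.
apply: smooth_on_ext (smooth_on_chart Ed0 Ed sL) => // _ [z [d0z dz] <-].
rewrite c_mapK //= /fiber_coord asboolT; last exact/dc.
by rewrite dE // row_mxKl row_mxEr.
Qed.

Definition coord_covector j : Gamma (dual_bundle E) :=
  @MkGamma _ _ _ (dual_bundle E) _ (fiber_coord_smooth j).

End Coordinate_covector.

(** Near [p] the coordinates of a bundle chart are pulled-back functions and fibrewise linear
    functions, and a tangent vector is determined by its values on coordinates. *)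
Lemma tangent_tot_ext (p : tot E) (v w : tangent p) :
  (forall f, v (pullback_fun (@qE_smooth _ _ _ _ E) f) =
             w (pullback_fun (@qE_smooth _ _ _ _ E) f)) ->
  (forall eps, v (ell eps) = w (ell eps)) -> v = w.
Proof.
move=> vwq vwl; apply: tangent_ext => f.
have [c [h [d [Mc cx Ed B]]]] := vb_triv E (qE p); have [hlin dc dE] := B.
have oW := c_open c; rewrite -/(c_cod c) in oW.
have [chi [rho [K [schi srho cK KW [K0 rho1 rho_chi]]]]] := cutoff_row oW (c_cod_map cx).
have WW : c_cod c `<=` c_cod c by [].
have chi0 y : ~ K y -> chi y = 0 by case/K0.
have sx i : is_smooth (zext c (fun y => chi y * y 0 i)).
  apply: (zext_smooth Mc cK KW WW); last by move=> y /K0[-> _]; rewrite mul0r.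
  apply: (smooth_onM oW) => l; [exact: Ck_sub (schi l)|exact: Ck_coord].
have sRho : is_smooth (zext c rho).
  apply: (zext_smooth Mc cK KW WW) => [l|y /K0[]//]; exact: Ck_sub (srho l).
pose rhoM := pullback_fun (@qE_smooth _ _ _ _ E) (MkCinf sRho).
pose F (i : 'I_(n + k)) : Cinf (tot E) := match fintype.split i with
  | inl j => pullback_fun (@qE_smooth _ _ _ _ E) (MkCinf (sx j))
  | inr j => ell (coord_covector Mc Ed B schi cK KW chi0 j) end.
have dp : c_dom d p by exact/dc.
have nzp : [set x | rhoM x != 0] p by rewrite /= zextE // rho1 oner_neq0.
have FE i x : [set x | rhoM x != 0] x -> c_dom d x -> F i x = d x 0 i.
  rewrite /= => nz /[dup] dx /dc cqx; move: nz; rewrite zextE // => /rho_chi chi1.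
  rewrite dE // /F; case: (fintype.splitP i) => j ij.
    have -> : i = lshift k j by exact: val_inj.
    by rewrite row_mxEl /= zextE // chi1 mul1r.
  have -> : i = rshift n j by exact: val_inj.
  by rewrite row_mxEr /= /fiber_coord asboolT // chi1 mul1r.
rewrite !(tangent_coord _ f Ed dp (@chart_open_neq0 _ _ _ rhoM) nzp FE).
by apply: eq_bigr => i _; congr (_ * _); rewrite /F; case: (fintype.split i).
Qed.

End Bundle_sections.

(** * Forms tested on projectable vector fields *)

Lemma form_ext (R : realType) n (N : manifold R n) (L1 L2 : Defs.form N) :
  (forall W, L1 W = L2 W) -> L1 = L2.
Proof.
case: L1 L2 => [f1 [[c1] [c2]]] [f2 [[d1] [d2]]] /= /funext f12.
case: _ / f12 in d1 d2 *.
by rewrite (Prop_irrelevance c1 d1) (Prop_irrelevance c2 d2).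
Qed.

Lemma gamma_sumE (R : realType) n (N : manifold R n) (F : Defs.family N) m (s : 'I_m -> Gamma F) p :
  (\sum_i s i) p = \sum_i s i p.
Proof.
elim: m s => [|m IH] s; first by rewrite !big_ord0.
by rewrite !big_ord_recl gammaDE IH.
Qed.

Section Projectable.
Variables (R : realType) (n k : nat) (M : manifold R n) (E : vbundle M k).
Local Notation q_ f := (pullback_fun (@qE_smooth _ _ _ _ E) f).

(** Relatedness under the bundle projection, in terms of derivations, which makes its stability
    under Lie brackets a computation. *)
Definition projects_to (W : Gamma (tangent_bundle (tot E)))
    (Y : Gamma (tangent_bundle M)) : Prop :=
  forall f, vf_app W (q_ f) = q_ (vf_app Y f).

Lemma projects_to_lie W1 W2 Y1 Y2 :
  projects_to W1 Y1 -> projects_to W2 Y2 -> projects_to (lie W1 W2) (lie Y1 Y2).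
Proof.
move=> H1 H2 f; rewrite !lieE !(H1, H2).
by apply: cinf_ext => p; rewrite !(cinfDE, cinfNE) /= !mulN1r.
Qed.

Lemma push_projects W Y p : projects_to W Y ->
  push (@qE_smooth _ _ _ _ E) (W p) = Y (qE p).
Proof.
move=> WY; apply: tangent_ext => f; have := WY f.
by move=> /(congr1 (fun g : Cinf _ => g p)).
Qed.

(** Forms are linear over functions. Near a point [W] is a function combination of lifts of base
    fields plus a vertical field, and the latter projects to 0. *)
Lemma form_eq_on_projectable (L1 L2 : Defs.form (tot E)) :
  (forall Y, exists W, projects_to W Y) ->
  (forall W Y, projects_to W Y -> L1 W = L2 W) -> L1 = L2.
Proof.
move=> lift H; apply: form_ext => W; apply: cinf_ext => p.
have [rho [x [Y [rho1 basis]]]] := partial_dual_basis (qE p).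
pose Yh i := projT1 (cid (lift (Y i))).
have YhP i : projects_to (Yh i) (Y i) by rewrite /Yh; case: cid.
(* Where rho <> 0, W minus its horizontal part is vertical. *)
pose V := q_ rho *: (W - \sum_i vf_app W (q_ (x i)) *: Yh i).
have V0 : projects_to V 0.
  move=> f; apply: cinf_ext => z.
  have := basis _ (push (@qE_smooth _ _ _ _ E) (W z)) f.
  rewrite /V vf_appE gammaZE gammaDE gammaNE tanZE tanDE tanNE gamma_sumE => Ez.
  have -> : (\sum_i (vf_app W (q_ (x i)) *: Yh i) z) (q_ f) =
      \sum_i vf_app W (q_ (x i)) z * Y i (qE z) f.
    elim: (index_enum _) => [|i s IH]; first by rewrite !big_nil.
    rewrite !big_cons tanDE IH gammaZE tanZE; congr (_ * _ + _).
    by have /(congr1 (fun g : Cinf _ => g z)) := YhP i f.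
  by rewrite mulrBr [X in X - _]Ez subrr.
pose S : Gamma (tangent_bundle (tot E)) := \sum_i vf_app W (q_ (x i)) *: Yh i.
have LS : L1 S = L2 S.
  rewrite /S !linear_sum; apply: eq_bigr => i _; rewrite !linearZ.
  by rewrite (H _ _ (YhP i)).
have := H _ _ V0; rewrite /V -/S !linearZ !linearB LS => /(congr1 (fun g : Cinf _ => g p)).
rewrite /= rho1 !mul1r => /addIr; exact.
Qed.

End Projectable.

(** * The lift of a bracket *)

Section Lift.
Variables (R : realType) (n k : nat) (M : manifold R n) (E : vbundle M k).
Local Notation q_ f := (pullback_fun (@qE_smooth _ _ _ _ E) f).

Lemma vert_pullback (p : tot E) (b : E (qE p)) f : vert b (q_ f) = 0.
Proof. exact: (@derive_cst R R R (f (qE p)) 0 1). Qed.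

Lemma vert_ell (p : tot E) (b : E (qE p)) eps : vert b (ell eps) = eps (qE p) b.
Proof.
rewrite /= /vert_fun /=.
have -> : (fun t : R => eps (projT1 p) (projT2 p + t *: b)) =
    cst (eps (projT1 p) (projT2 p)) + (eps (projT1 p) b \*: id).
  by apply/funext => t; rewrite dual_mapD dual_mapZ mulrC.
rewrite deriveD; [|exact: derivable_cst|exact/derivableZ/derivable_id].
by rewrite derive_cst add0r deriveZ ?derive_id ?[_ *: _]mulr1.
Qed.

Lemma ellD (a b : Gamma (dual_bundle E)) : ell (a + b) = ell a + ell b.
Proof.
apply: cinf_ext => p; rewrite cinfDE.
by rewrite -[LHS]/((a + b) (qE p) (projT2 p)) gammaDE dualDE.
Qed.

Lemma ellN (a : Gamma (dual_bundle E)) : ell (- a) = - ell a.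
Proof. by apply: (addrI (ell a)); rewrite -ellD !subrr; apply: cinf_ext. Qed.

Lemma ell_inj (a b : Gamma (dual_bundle E)) : ell a = ell b -> a = b.
Proof.
move=> ab; apply: gamma_ext => m; apply: dual_ext => u.
by have /(congr1 (fun g : Cinf _ => g (pt u))) := ab.
Qed.

Variables (br : bracket E).
Hypotheses (br_bilinear : R_bilinear br) (br_anchored : anchored br).

Definition jacobiator nu1 nu2 nu3 : sec_TM_Edual E :=
  br nu1 (br nu2 nu3) - br (br nu1 nu2) nu3 - br nu2 (br nu1 nu3).

Lemma brDr nu mu1 mu2 : br nu (mu1 + mu2) = br nu mu1 + br nu mu2.
Proof.
have [_ /(_ 1 nu mu1 mu2)] := br_bilinear.
by rewrite -[cinf_cst M 1]/(1 : Cinf M) !scale1r.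
Qed.

Lemma br_splitr nu (mu : sec_TM_Edual E) : br nu mu = br nu (mu.1, 0) + br nu (0, mu.2).
Proof. by rewrite -brDr; congr br; case: mu => a b; congr pair; rewrite /= ?addr0 ?add0r. Qed.

(** Reduces the Jacobi identity to the third arguments [(Y, 0)] and [(0, eps)], which naturality
    detects through the form and the vector field respectively. *)
Lemma jacobiator_splitr nu1 nu2 mu :
  jacobiator nu1 nu2 mu = jacobiator nu1 nu2 (mu.1, 0) + jacobiator nu1 nu2 (0, mu.2).
Proof.
rewrite /jacobiator (br_splitr nu2 mu) (br_splitr nu1 mu) (br_splitr (br nu1 nu2) mu).
rewrite !brDr !opprD [br nu1 _ + _ + _]addrACA; exact: addrACA.
Qed.

Lemma lie_jacobi (X Y Z : Gamma (tangent_bundle M)) :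
  lie X (lie Y Z) - lie (lie X Y) Z - lie Y (lie X Z) = 0.
Proof.
apply: gamma_ext => p; apply: tangent_ext => f.
have E1 (A B : Gamma (tangent_bundle M)) : vf_app (A - B) f = vf_app A f - vf_app B f.
  by apply: cinf_ext => x; rewrite cinfDE cinfNE !vf_appE gammaDE gammaNE tanDE tanNE.
rewrite -!vf_appE; congr (cinf_fun _ p); rewrite !E1 !lieE !(vf_appD, vf_appN).
have -> : vf_app 0 f = 0 by apply: cinf_ext.
by ring.
Qed.

Variables (Xi : sec_TM_Edual E -> linear_section E)
  (D : sec_TM_Edual E -> sec_E_TdualM E -> sec_E_TdualM E).
Hypotheses (D_dual : forall nu, dual_derivation br nu (D nu))
  (XiE : forall nu (e : Gamma (bundle_sections E)) (m : M),
      let p := sec_map e m in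
      sec_at (Xi nu) p =
      (push (sec_smooth e) (nu.1 m), dfun (ell nu.2) p) - core_lift (D nu (e, 0)) p).

Lemma lift_tangentE nu e m g : (lin_sec (Xi nu)).1 (sec_map e m) g =
  vf_app nu.1 (pullback_fun (sec_smooth e) g) m -
  vert (p := sec_map e m) ((D nu (e, 0)).1 m) g.
Proof.
have /(congr1 fst) := XiE nu e m; rewrite /= => ->.
by rewrite tanDE tanNE.
Qed.

Lemma lift_covectorE nu e m (w : tangent (sec_map e m)) :
  (lin_sec (Xi nu)).2 (sec_map e m) w = w (ell nu.2) -
  (D nu (e, 0)).2 m (push (@qE_smooth _ _ _ _ E) w).
Proof.
have /(congr1 snd) := XiE nu e m; rewrite /= => ->.
by rewrite dualDE dualNE.
Qed.

Lemma pairing_ellE (nu : sec_TM_Edual E) e :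
  pairing nu (e, 0) = pullback_fun (sec_smooth e) (ell nu.2).
Proof. by apply: cinf_ext => m; rewrite pairingE /= addr0. Qed.

(** The vertical correction kills pulled-back functions, and [sec_map e] followed by the projection
    is the identity. *)
Lemma lift_projects nu : projects_to (lin_sec (Xi nu)).1 nu.1.
Proof.
move=> f; apply: cinf_ext => p; have [e <-] := section_through p.
rewrite vf_appE lift_tangentE vert_pullback subr0 vf_appE.
by congr (nu.1 _ _); apply: cinf_ext.
Qed.

(** The duality defining [D nu], read on [(0, eps)] and [(e, 0)]: the vertical correction removes
    the term with [D nu] and leaves the bracket. *)
Lemma lift_ell nu eps : vf_app (lin_sec (Xi nu)).1 (ell eps) = ell (br nu (0, eps)).2.
Proof.
apply: cinf_ext => p; have [e <-] := section_through p; set m := qE p.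
rewrite vf_appE lift_tangentE vert_ell.
have [_ /(_ (0, eps) (e, 0))] := D_dual nu.
rewrite !pairing_ellE => /(congr1 (fun g : Cinf _ => g m)) ->.
rewrite cinfDE pairingE /= dual_map0 addr0.
by rewrite addrAC subrr add0r.
Qed.

(** The same duality on [(Y, 0)] and [(e, 0)], whose pairing is 0, so that the correction by [D nu]
    equals the bracket term up to sign. *)
Lemma lift_form nu W Y : projects_to W Y ->
  form_app (lin_sec (Xi nu)).2 W = vf_app W (ell nu.2) + ell (br nu (Y, 0)).2.
Proof.
move=> WY; apply: cinf_ext => p; have [e <-] := section_through p; set m := qE p.
rewrite form_appE lift_covectorE cinfDE vf_appE (push_projects _ WY).
have [_ /(_ (Y, 0) (e, 0))] := D_dual nu.
rewrite !pairing_ellE => /(congr1 (fun g : Cinf _ => g m)).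
have -> : pullback_fun (sec_smooth e) (ell (Y, 0 : Gamma (dual_bundle E)).2) = 0.
  exact: cinf_ext.
rewrite cinfDE pairingE /= tan_map0 add0r => /esym/eqP; rewrite addr_eq0 => /eqP H.
by congr (_ + _); rewrite H opprK.
Qed.

(** By the anchor, bracketing with [(0, eps)] has no tangent part; hence [lift_ell] can be iterated
    and the commutator compared with the lift of the bracket. *)
Lemma lie_lift_ell nu1 nu2 eps :
  vf_app (lie (lin_sec (Xi nu1)).1 (lin_sec (Xi nu2)).1) (ell eps) =
  vf_app (lin_sec (Xi (br nu1 nu2))).1 (ell eps) + ell (jacobiator nu1 nu2 (0, eps)).2.
Proof.
have lie0 X : lie X 0 = 0 :> Gamma (tangent_bundle M).
  by apply: (addrI (lie X 0)); rewrite -lieDr !addr0.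
have br0 nu eta : br nu (0, eta) = (0, (br nu (0, eta)).2).
  by rewrite [LHS]surjective_pairing br_anchored lie0.
rewrite lieE !lift_ell -[(0, (br nu2 _).2)]br0 -[(0, (br nu1 _).2)]br0.
by rewrite /jacobiator /= !ellD !ellN; ring.
Qed.

(** After expansion the second-order terms in [ell nu1.2] cancel, those in [ell nu2.2] collapse to
    [W] applied to [ell (br nu1 (0, nu2.2)).2], and the remaining iterated brackets differ from the
    lift by the Jacobiator. *)
Lemma cd_lift_form nu1 nu2 W Y : projects_to W Y ->
  lie_deriv (lin_sec (Xi nu1)).1 (lin_sec (Xi nu2)).2 W - dform (lin_sec (Xi nu1)).2 (lin_sec (Xi nu2)).1 W =
  form_app (lin_sec (Xi (br nu1 nu2))).2 W + ell (jacobiator nu1 nu2 (Y, 0)).2.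
Proof.
move=> WY; have P nu := lift_projects nu.
rewrite /lie_deriv /dform !(lift_form _ WY).
rewrite !(lift_form _ (projects_to_lie (P _) WY)) (lift_form _ (P nu2)).
rewrite !lieE !vf_appD !lift_ell.
have E2 : ell (br nu1 nu2).2 = ell (br nu1 (0, nu2.2)).2 + ell (br nu1 (nu2.1, 0)).2.
  by rewrite br_splitr /= ellD addrC.
(* By the anchor the tangent part of [br mu (Z, 0)] is a Lie bracket, so the iterated bracket splits
   into the terms that [lift_ell] and [lift_form] produce. *)
have EJ (nu mu : sec_TM_Edual E) Z : lie mu.1 Z = (br mu (Z, 0)).1 ->
    ell (br nu (br mu (Z, 0))).2 =
    ell (br nu (0, (br mu (Z, 0)).2)).2 + ell (br nu (lie mu.1 Z, 0)).2.
  by move=> ->; rewrite (br_splitr nu (br mu _)) /= ellD addrC.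
rewrite /jacobiator /= !ellD !ellN !EJ ?br_anchored // E2 !vf_appD.
by ring.
Qed.

(** Both defects from naturality are [ell] of second components of Jacobiators, and [ell] is
    injective. The tangent component of the Jacobiator vanishes by the Jacobi identity of vector
    fields. *)
Lemma natural_lift_iff : natural_lift br Xi <->
  forall nu1 nu2 nu3, jacobiator nu1 nu2 nu3 = 0.
Proof.
split=> [nat nu1 nu2 nu3|jac nu1 nu2].
  have ell0 (mu : Gamma (dual_bundle E)) : ell mu = 0 -> mu = 0.
    by move=> mu0; apply: ell_inj; rewrite mu0; apply: cinf_ext.
  have N1 := congr1 fst (nat nu1 nu2); have N2 := congr1 snd (nat nu1 nu2).
  rewrite /= in N1 N2.
  have J1 eps : (jacobiator nu1 nu2 (0, eps)).2 = 0.
    apply: ell0; have := lie_lift_ell nu1 nu2 eps; rewrite N1.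
    by rewrite -[LHS]addr0 => /addrI.
  (* The vector field of [Xi (Y, 0)] serves as test field projecting to [Y]. *)
  have J2 Y : (jacobiator nu1 nu2 (Y, 0)).2 = 0.
    apply: ell0; have := cd_lift_form nu1 nu2 (lift_projects (Y, 0)).
    have /= -> := congr1 (fun L : Defs.form (tot E) => L (lin_sec (Xi (Y, 0))).1) N2.
    by rewrite -[LHS]addr0 => /addrI.
  rewrite [LHS]surjective_pairing; congr pair.
    by rewrite /jacobiator /= !br_anchored lie_jacobi.
  rewrite jacobiator_splitr -[LHS]/((jacobiator _ _ _).2 + (jacobiator _ _ _).2).
  by rewrite J1 J2 addr0.
have ellj nu3 : ell (jacobiator nu1 nu2 nu3).2 = 0 by rewrite jac; apply: cinf_ext.
have F : (courant_dorfman (lin_sec (Xi nu1)) (lin_sec (Xi nu2))).2 = form_of (lin_sec (Xi (br nu1 nu2))).2.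
  apply: form_eq_on_projectable => [Y|W Y WY].
    by exists (lin_sec (Xi (Y, 0))).1; exact: lift_projects.
  by have := cd_lift_form nu1 nu2 WY; rewrite ellj addr0.
rewrite [LHS]surjective_pairing F; congr pair.
apply: gamma_ext => p; apply: tangent_tot_ext => [f|eps].
  rewrite -!vf_appE (projects_to_lie (lift_projects nu1) (lift_projects nu2)).
  by rewrite lift_projects br_anchored.
by rewrite -!vf_appE lie_lift_ell ellj addr0.
Qed.

End Lift.

Theorem theorem4p2 (R : realType) (n k : nat) (M : manifold R n)
    (E : vbundle M k) (br : bracket E)
    (br_bilinear : R_bilinear br) (br_anchored : anchored br)
    (br_leibniz : leibniz2 br)
    (Xi : sec_TM_Edual E -> linear_section E) (Xi_lift : lift_of br Xi) :
  dorfman_bracket br <-> natural_lift br Xi.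
Proof.
have [D [D_dual XiE]] := Xi_lift.
rewrite (natural_lift_iff br_bilinear br_anchored D_dual XiE).
have jacE nu1 nu2 nu3 : jacobiator br nu1 nu2 nu3 = 0 <->
    br nu1 (br nu2 nu3) = br (br nu1 nu2) nu3 + br nu2 (br nu1 nu3).
  by rewrite /jacobiator -addrA -opprD; split=> [/subr0_eq|->] //; rewrite subrr.
split=> [[_ _ _ jac] nu1 nu2 nu3|jac]; first exact/jacE.
by split=> // nu1 nu2 nu3; apply/jacE.
Qed.
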